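(* Suppose $h\in C^2(\overline R)$ with finite $C^2$ norm is a solution of the height equation with $\inf_R h_p>0$, and that there are functions $H_\pm$ on $[-1,0]$ with $h(q,p)\to H_\pm(p)$ pointwise as $q\to\pm\infty$. If $$H_+\ge H_-=H\ \text{on }[-1,0]\qquad\text{or}\qquad H_+\le H_-=H\ \text{on }[-1,0],$$ then $H_+=H_-=H$. The same holds with the roles of $H_-$ and $H_+$ interchanged.
   Context: Fix $\alpha\in(0,1)$, $\rho\in C^{2+\alpha}([-1,0])$ with $\rho>0$, $\rho_p\le0$, $H\in C^{3+\alpha}([-1,0])$ with $H(-1)=0$, $H(0)=1$, $H_p>0$, and $F>0$. Let $R=\mathbb R\times(-1,0)$ (coordinates $(q,p)$), $T=\mathbb R\times\{0\}$, $B=\mathbb R\times\{-1\}$. The height equation for $h$ is $\big(-\frac{1+h_q^2}{2h_p^2}+\frac1{2H_p^2}\big)_p+\big(\frac{h_q}{h_p}\big)_q-\frac1{F^2}\rho_p(h-H)=0$ in $R$, $\frac{1+h_q^2}{2h_p^2}-\frac1{2H_p^2}+\frac1{F^2}\rho(h-1)=0$ on $T$, $h=0$ on $B$. *)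

(* Defs.v *)
From Stdlib Require Import Reals.
From Coquelicot Require Import Coquelicot.
Open Scope R_scope.

Definition Ip (p : R) : Prop := -1 <= p <= 0.

Definition has_deriv_on (D : R -> Prop) (f f' : R -> R) : Prop :=
  forall x, D x ->
    filterlim (fun y => (f y - f x) / (y - x))
      (within (fun y => D y /\ y <> x) (locally x)) (locally (f' x)).

Definition holder_on (D : R -> Prop) (a : R) (f : R -> R) : Prop :=
  exists C, 0 <= C /\ forall x y, D x -> D y -> x <> y ->
    Rabs (f x - f y) <= C * Rpower (Rabs (x - y)) a.

Definition C2a (a : R) (f : R -> R) : Prop :=
  exists f1 f2, has_deriv_on Ip f f1 /\ has_deriv_on Ip f1 f2 /\ holder_on Ip a f2.

Definition C3a (a : R) (f : R -> R) : Prop :=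
  exists f1 f2 f3, has_deriv_on Ip f f1 /\ has_deriv_on Ip f1 f2 /\
    has_deriv_on Ip f2 f3 /\ holder_on Ip a f3.

Definition cont_strip (g : R -> R -> R) : Prop :=
  forall q p, Ip p -> forall eps, 0 < eps -> exists del, 0 < del /\
    forall q' p', Ip p' -> Rabs (q' - q) < del -> Rabs (p' - p) < del ->
      Rabs (g q' p' - g q p) < eps.

Definition C2_bounded_strip (h hq hp : R -> R -> R) : Prop :=
  (forall q p, Ip p -> is_derive (fun q' => h q' p) q (hq q p)) /\
  (forall q, has_deriv_on Ip (fun p' => h q p') (fun p' => hp q p')) /\
  exists hqq hqp hpq hpp : R -> R -> R,
    (forall q p, Ip p -> is_derive (fun q' => hq q' p) q (hqq q p)) /\
    (forall q, has_deriv_on Ip (fun p' => hq q p') (fun p' => hqp q p')) /\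
    (forall q p, Ip p -> is_derive (fun q' => hp q' p) q (hpq q p)) /\
    (forall q, has_deriv_on Ip (fun p' => hp q p') (fun p' => hpp q p')) /\
    cont_strip h /\ cont_strip hq /\ cont_strip hp /\ cont_strip hqq /\
    cont_strip hqp /\ cont_strip hpq /\ cont_strip hpp /\
    exists M, forall q p, Ip p ->
      Rabs (h q p) <= M /\ Rabs (hq q p) <= M /\ Rabs (hp q p) <= M /\
      Rabs (hqq q p) <= M /\ Rabs (hqp q p) <= M /\ Rabs (hpq q p) <= M /\
      Rabs (hpp q p) <= M.

Definition height_eq (F : R) (rho rho_p H H_p : R -> R)
    (h hq hp : R -> R -> R) : Prop :=
  (forall q p, -1 < p < 0 ->
     Derive (fun p' => - (1 + (hq q p') ^ 2) / (2 * (hp q p') ^ 2)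
                       + 1 / (2 * (H_p p') ^ 2)) p
     + Derive (fun q' => hq q' p / hp q' p) q
     - / F ^ 2 * rho_p p * (h q p - H p) = 0) /\
  (forall q, (1 + (hq q 0) ^ 2) / (2 * (hp q 0) ^ 2) - 1 / (2 * (H_p 0) ^ 2)
             + / F ^ 2 * rho 0 * (h q 0 - 1) = 0) /\
  (forall q, h q (-1) = 0).

(* Main.v *)
Require Import Defs.
From Stdlib Require Import Reals Lra Lia IndefiniteDescription.
From Coquelicot Require Import Coquelicot.
Open Scope R_scope.

(** Put w = h - H, sigma = rho / F^2 and A = - (1 + h_q^2) / (2 h_p^2) + 1 / (2 H_p^2).
    The flow force
      S(q) = int_{-1}^0 (1 - h_q^2) / (2 h_p) + h_p / (2 H_p^2) - 1 / H_p - sigma w w_p dp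
    does not depend on q: its q-derivative is the integral of the p-derivative of
    (A - sigma w) h_q, which vanishes on both walls.  The C^2 bounds upgrade the pointwise
    limits of h to limits of h_p, and force h_q -> 0; hence a limit K has the same flow
    force S, and, as int_p^0 h_q / h_p -> 0, satisfies the integrated equation
    A_K(0) - A_K(p) = int_p^0 sigma_p W with W = K - H.  If one limit is H then S = 0.
    For the other limit, subtracting 2 S from the integral of (A_K W - sigma W^2)_p = 0
    leaves int_{-1}^0 W_p^3 / (2 K_p^2 H_p^2) dp = 0.  A sign of W gives A_K, hence W_p,
    the same sign, so W_p = 0 and W = 0. *)

(** The obstacle is that the $C^2$ bounds give equi-Lipschitz control in p of h, h_q and h_p, hence
    uniform convergence of these three, but no convergence of second derivatives. A limit K is
    therefore only handled as a C^1 profile, and the interior equation has to be integrated in p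
    before q goes to infinity. The one q-derivative left is that of the integral of h_q / h_p; a
    function and its derivative can both converge only if the derivative tends to 0. The cube comes
    from a cancellation of the quadratic terms: A_K W_p = W_p^2 (K_p + H_p) / (2 K_p^2 H_p^2), while
    twice the flow-force density, apart from its sigma term, is W_p^2 / (K_p H_p^2). The remaining
    odd power gives no information unless W_p keeps one sign, and this is where the ordering of the
    limits enters. A filter stable under shifts by at most 1 stands for either infinity and a sign e
    = 1 or e = -1 for either ordering, so that one argument serves all four cases. *)

(** * Continuity and integrals on the line *)

Lemma is_derive_continuous (f : R -> R) (x l : R) :
  is_derive f x l -> continuous f x.
Proof. intros Hf. apply (ex_derive_continuous (V := R_NormedModule)). now exists l. Qed.

Lemma continuous_plus_R (f g : R -> R) (x : R) :
  continuous f x -> continuous g x -> continuous (fun y => f y + g y) x.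
Proof. intros; now apply (continuous_plus (V := R_NormedModule) f g). Qed.

Lemma continuous_opp_R (f : R -> R) (x : R) :
  continuous f x -> continuous (fun y => - f y) x.
Proof. intros; now apply (continuous_opp (V := R_NormedModule) f). Qed.

Lemma continuous_mult_R (f g : R -> R) (x : R) :
  continuous f x -> continuous g x -> continuous (fun y => f y * g y) x.
Proof. intros; now apply (continuous_mult (K := R_AbsRing) f g). Qed.

Lemma continuous_minus_R (f g : R -> R) (x : R) :
  continuous f x -> continuous g x -> continuous (fun y => f y - g y) x.
Proof. intros; now apply (continuous_minus (V := R_NormedModule) f g). Qed.

Ltac cont1 :=
  lazymatch goal with
  | |- continuous (fun _ => ?c) _ => apply continuous_const
  | |- continuous (fun _ => _ + _) _ => apply continuous_plus_R; cont1
  | |- continuous (fun _ => _ - _) _ => apply continuous_minus_R; cont1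
  | |- continuous (fun _ => - _) _ => apply continuous_opp_R; cont1
  | |- continuous (fun _ => _ * _) _ => apply continuous_mult_R; cont1
  | |- continuous (fun _ => / _) _ => apply continuous_Rinv_comp; [cont1 |]
  | |- continuous _ _ => try assumption
  end.

Ltac cont2 :=
  lazymatch goal with
  | |- continuity_2d_pt (fun _ _ => ?c) _ _ => apply continuity_2d_pt_const
  | |- continuity_2d_pt (fun _ _ => _ + _) _ _ => apply continuity_2d_pt_plus; cont2
  | |- continuity_2d_pt (fun _ _ => _ - _) _ _ => apply continuity_2d_pt_minus; cont2
  | |- continuity_2d_pt (fun _ _ => - _) _ _ => apply continuity_2d_pt_opp; cont2
  | |- continuity_2d_pt (fun _ _ => _ * _) _ _ => apply continuity_2d_pt_mult; cont2
  | |- continuity_2d_pt (fun _ _ => / _) _ _ => apply continuity_2d_pt_inv; [cont2 |]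
  | |- continuity_2d_pt _ _ _ => try assumption
  end.

Lemma ex_RInt_cont (f : R -> R) (a b : R) :
  (forall x, continuous f x) -> ex_RInt f a b.
Proof. intros Hf. apply (ex_RInt_continuous (V := R_CompleteNormedModule)). intros; apply Hf. Qed.

Lemma is_derive_RInt_cont (f : R -> R) (a x : R) :
  (forall x, continuous f x) -> is_derive (fun y => RInt f a y) x (f x).
Proof.
  intros Hf. apply (is_derive_RInt (V := R_NormedModule) f (RInt f a) a x); [|apply Hf].
  apply filter_forall. intros y. apply (RInt_correct (V := R_CompleteNormedModule)).
  now apply ex_RInt_cont.
Qed.

(** Functions clamped to [-1, 0] may have corners at the ends, so the derivative is asked for only
    inside, with continuity everywhere. The difference between [f] and the primitive of [f'] is
    constant by the mean value theorem. *)
Lemma FTC_open (f f' : R -> R) (a b : R) :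
  a <= b -> (forall x, a < x < b -> is_derive f x (f' x)) ->
  (forall x, continuous f x) -> (forall x, continuous f' x) ->
  RInt f' a b = f b - f a.
Proof.
  intros Hab Hd Hc Hc'.
  destruct (MVT_gen (fun x => f x - RInt f' a x) a b (fun _ => 0)) as [z [_ E]].
  - rewrite Rmin_left, Rmax_right by lra. intros x Hx.
    replace 0 with (f' x - f' x) by ring.
    apply (is_derive_minus (V := R_NormedModule) f (fun y => RInt f' a y)).
    + now apply Hd.
    + now apply is_derive_RInt_cont.
  - intros x _. apply continuity_pt_filterlim.
    apply (continuous_minus_R f (fun y => RInt f' a y)); [apply Hc|].
    apply (is_derive_continuous _ _ (f' x)). now apply is_derive_RInt_cont.
  - rewrite RInt_point in E. unfold zero in E; simpl in E. lra.
Qed.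

(** The integrals over [a, y] and [y, b] are nonnegative and add up to zero, so the primitive of [f]
    vanishes identically; differentiating it gives the claim. *)
Lemma RInt_zero_nonneg (f : R -> R) (a b : R) :
  (forall x, continuous f x) -> (forall x, a < x < b -> 0 <= f x) ->
  RInt f a b = 0 -> forall x, a < x < b -> f x = 0.
Proof.
  intros Hc Hp HI x Hx.
  assert (Hz : forall y, a <= y <= b -> RInt f a y = 0).
  { intros y Hy.
    assert (H1 : 0 <= RInt f a y)
      by (apply RInt_ge_0; [lra | now apply ex_RInt_cont | intros; apply Hp; lra]).
    assert (H2 : 0 <= RInt f y b)
      by (apply RInt_ge_0; [lra | now apply ex_RInt_cont | intros; apply Hp; lra]).
    assert (H3 : RInt f a y + RInt f y b = RInt f a b)
      by (apply (RInt_Chasles (V := R_CompleteNormedModule) f); now apply ex_RInt_cont).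
    lra. }
  rewrite <- (is_derive_unique _ _ _ (is_derive_RInt_cont f a x Hc)).
  apply is_derive_unique.
  apply (is_derive_ext_loc (V := R_NormedModule) (fun _ => 0)).
  - apply (locally_interval _ x a b); simpl; try lra.
    intros y Hy1 Hy2. symmetry; apply Hz; lra.
  - apply (is_derive_const (V := R_NormedModule)).
Qed.

(* Clamping to [-1, 0] turns functions on the closed strip into functions on the
   whole plane, so that one-sided limits at the walls become plain continuity. *)
Definition clamp (p : R) : R := Rmax (-1) (Rmin p 0).

Lemma clamp_Ip (p : R) : Ip (clamp p).
Proof.
  unfold Ip, clamp. split; [apply Rmax_l|].
  apply Rmax_lub; [lra | apply Rmin_r].
Qed.

Lemma clamp_id (p : R) : Ip p -> clamp p = p.
Proof. intros [H1 H2]. unfold clamp. rewrite Rmin_left, Rmax_right; lra. Qed.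

Lemma clamp_lipschitz (x y : R) : Rabs (clamp x - clamp y) <= Rabs (x - y).
Proof.
  unfold clamp, Rmax, Rmin, Rabs.
  repeat (destruct Rle_dec || destruct Rcase_abs); lra.
Qed.

(** * Convergence along a filter *)

Definition conv (Fl : (R -> Prop) -> Prop) (f : R -> R) (l : R) : Prop :=
  forall eps, 0 < eps -> Fl (fun q => Rabs (f q - l) < eps).

(** Uniformity in [p] lets limits pass under integrals, and the global bound makes the notion stable
    under products. Letting [p] range over the whole line costs nothing for families clamped to
    [-1, 0]. *)
Definition bconv (Fl : (R -> Prop) -> Prop) (f : R -> R -> R) (g : R -> R) : Prop :=
  (exists M, forall q p, Rabs (f q p) <= M) /\
  forall eps, 0 < eps -> Fl (fun q => forall p, Rabs (f q p - g p) < eps).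

Section Filters.

Context (Fl : (R -> Prop) -> Prop) {PF : ProperFilter Fl}.

Lemma conv_unique (f : R -> R) (l l' : R) : conv Fl f l -> conv Fl f l' -> l = l'.
Proof.
  intros H1 H2. destruct (Req_dec l l') as [|Hn]; [assumption|exfalso].
  assert (He : 0 < Rabs (l - l') / 2) by (apply Rdiv_lt_0_compat; [apply Rabs_pos_lt|]; lra).
  destruct (filter_ex _ (filter_and (F := Fl) _ _ (H1 _ He) (H2 _ He))) as [q [A B]].
  assert (Rabs (l - l') <= Rabs (f q - l') + Rabs (f q - l)).
  { replace (l - l') with ((f q - l') + - (f q - l)) by ring.
    eapply Rle_trans; [apply Rabs_triang|]. rewrite Rabs_Ropp. lra. }
  lra.
Qed.

Lemma conv_bound (f : R -> R) (l a M : R) :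
  conv Fl f l -> Fl (fun q => Rabs (f q - a) <= M) -> Rabs (l - a) <= M.
Proof.
  intros Hf HM. apply Rnot_lt_le. intros Hl.
  destruct (filter_ex _ (filter_and (F := Fl) _ _ HM (Hf (Rabs (l - a) - M) ltac:(lra)))) as [q [A B]].
  assert (Rabs (l - a) <= Rabs (f q - a) + Rabs (f q - l)).
  { replace (l - a) with ((f q - a) + - (f q - l)) by ring.
    eapply Rle_trans; [apply Rabs_triang|]. rewrite Rabs_Ropp. lra. }
  lra.
Qed.

Lemma conv_plus (f g : R -> R) (a b : R) :
  conv Fl f a -> conv Fl g b -> conv Fl (fun q => f q + g q) (a + b).
Proof.
  intros Hf Hg eps He.
  generalize (filter_and (F := Fl) _ _ (Hf (eps / 2) ltac:(lra)) (Hg (eps / 2) ltac:(lra))).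
  apply filter_imp. intros q [A B].
  replace (f q + g q - (a + b)) with ((f q - a) + (g q - b)) by ring.
  eapply Rle_lt_trans; [apply Rabs_triang|]. lra.
Qed.

Lemma conv_opp (f : R -> R) (a : R) : conv Fl f a -> conv Fl (fun q => - f q) (- a).
Proof.
  intros Hf eps He. generalize (Hf eps He). apply filter_imp. intros q A.
  replace (- f q - - a) with (- (f q - a)) by ring. now rewrite Rabs_Ropp.
Qed.

Lemma bconv_conv (f : R -> R -> R) (g : R -> R) (p : R) :
  bconv Fl f g -> conv Fl (fun q => f q p) (g p).
Proof.
  intros [_ Hf] eps He. generalize (Hf eps He). apply filter_imp. auto.
Qed.

Lemma bconv_bounded (f : R -> R -> R) (g : R -> R) :
  bconv Fl f g -> exists M, 0 < M /\ (forall q p, Rabs (f q p) <= M) /\ forall p, Rabs (g p) <= M.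
Proof.
  intros Hfg. destruct (Hfg) as [[M HM] _].
  exists (Rmax M 1). split; [|split].
  - apply Rlt_le_trans with 1; [lra | apply Rmax_r].
  - intros q p. eapply Rle_trans; [apply HM | apply Rmax_l].
  - intros p. eapply Rle_trans; [|apply Rmax_l].
    replace (g p) with (g p - 0) by ring.
    apply (conv_bound (fun q => f q p)); [now apply bconv_conv|].
    apply filter_forall. intros q. rewrite Rminus_0_r. apply HM.
Qed.

Lemma bconv_const (g : R -> R) (M : R) :
  (forall p, Rabs (g p) <= M) -> bconv Fl (fun _ => g) g.
Proof.
  intros HM. split.
  - now exists M.
  - intros eps He. apply filter_forall. intros _ p. now rewrite Rminus_diag, Rabs_R0.
Qed.

Lemma bconv_plus (f1 f2 : R -> R -> R) (g1 g2 : R -> R) :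
  bconv Fl f1 g1 -> bconv Fl f2 g2 ->
  bconv Fl (fun q p => f1 q p + f2 q p) (fun p => g1 p + g2 p).
Proof.
  intros [[M1 B1] U1] [[M2 B2] U2]. split.
  - exists (M1 + M2). intros q p. eapply Rle_trans; [apply Rabs_triang|].
    specialize (B1 q p); specialize (B2 q p); lra.
  - intros eps He.
    generalize (filter_and (F := Fl) _ _ (U1 (eps / 2) ltac:(lra)) (U2 (eps / 2) ltac:(lra))).
    apply filter_imp. intros q [A B] p. specialize (A p); specialize (B p).
    replace (f1 q p + f2 q p - (g1 p + g2 p)) with ((f1 q p - g1 p) + (f2 q p - g2 p)) by ring.
    eapply Rle_lt_trans; [apply Rabs_triang|]. lra.
Qed.

Lemma bconv_opp (f : R -> R -> R) (g : R -> R) :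
  bconv Fl f g -> bconv Fl (fun q p => - f q p) (fun p => - g p).
Proof.
  intros [[M B] U]. split.
  - exists M. intros q p. rewrite Rabs_Ropp. apply B.
  - intros eps He. generalize (U eps He). apply filter_imp. intros q A p.
    replace (- f q p - - g p) with (- (f q p - g p)) by ring. rewrite Rabs_Ropp. apply A.
Qed.

Lemma bconv_minus (f1 f2 : R -> R -> R) (g1 g2 : R -> R) :
  bconv Fl f1 g1 -> bconv Fl f2 g2 ->
  bconv Fl (fun q p => f1 q p - f2 q p) (fun p => g1 p - g2 p).
Proof. intros H1 H2. apply bconv_plus; [|apply bconv_opp]; assumption. Qed.

Lemma bconv_mult (f1 f2 : R -> R -> R) (g1 g2 : R -> R) :
  bconv Fl f1 g1 -> bconv Fl f2 g2 ->
  bconv Fl (fun q p => f1 q p * f2 q p) (fun p => g1 p * g2 p).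
Proof.
  intros H1 H2.
  destruct (bconv_bounded _ _ H1) as [M1 [P1 [B1 _]]].
  destruct (bconv_bounded _ _ H2) as [M2 [P2 [_ B2]]].
  destruct H1 as [_ U1]. destruct H2 as [[M3 B3] U2]. split.
  - exists (M1 * M3). intros q p. rewrite Rabs_mult.
    apply Rmult_le_compat; auto using Rabs_pos.
  - intros eps He.
    assert (E1 : 0 < eps / (2 * M1)) by (apply Rdiv_lt_0_compat; lra).
    assert (E2 : 0 < eps / (2 * M2)) by (apply Rdiv_lt_0_compat; lra).
    generalize (filter_and (F := Fl) _ _ (U1 _ E2) (U2 _ E1)).
    apply filter_imp. intros q [A B] p. specialize (A p); specialize (B p).
    specialize (B1 q p); specialize (B2 p).
    replace (f1 q p * f2 q p - g1 p * g2 p)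
      with (f1 q p * (f2 q p - g2 p) + g2 p * (f1 q p - g1 p)) by ring.
    eapply Rle_lt_trans; [apply Rabs_triang|]. rewrite !Rabs_mult.
    assert (T1 : Rabs (f1 q p) * Rabs (f2 q p - g2 p) <= M1 * Rabs (f2 q p - g2 p))
      by (apply Rmult_le_compat_r; [apply Rabs_pos | assumption]).
    assert (T2 : Rabs (g2 p) * Rabs (f1 q p - g1 p) <= M2 * Rabs (f1 q p - g1 p))
      by (apply Rmult_le_compat_r; [apply Rabs_pos | assumption]).
    apply (Rmult_lt_compat_l M1) in B; [|assumption].
    apply (Rmult_lt_compat_l M2) in A; [|assumption].
    replace (M1 * (eps / (2 * M1))) with (eps / 2) in B by (field; lra).
    replace (M2 * (eps / (2 * M2))) with (eps / 2) in A by (field; lra).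
    lra.
Qed.

Lemma bconv_ge (f : R -> R -> R) (g : R -> R) (c : R) :
  bconv Fl f g -> (forall q p, c <= f q p) -> forall p, c <= g p.
Proof.
  intros [_ U] Hc p. apply Rnot_lt_le. intros Hl.
  destruct (filter_ex _ (U (c - g p) ltac:(lra))) as [q Hq].
  specialize (Hq p). specialize (Hc q p). apply Rabs_def2 in Hq. lra.
Qed.

Lemma bconv_inv (f : R -> R -> R) (g : R -> R) (c : R) :
  0 < c -> (forall q p, c <= f q p) ->
  bconv Fl f g -> bconv Fl (fun q p => / f q p) (fun p => / g p).
Proof.
  intros Hc Hf H. pose proof (bconv_ge _ _ _ H Hf) as Hg. destruct H as [_ U]. split.
  - exists (/ c). intros q p. specialize (Hf q p). rewrite Rabs_pos_eq.
    + apply Rinv_le_contravar; assumption.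
    + left. apply Rinv_0_lt_compat. lra.
  - intros eps He. assert (E : 0 < eps * (c * c)) by (apply Rmult_lt_0_compat; nra).
    generalize (U _ E). apply filter_imp. intros q A p. specialize (A p).
    specialize (Hf q p). specialize (Hg p).
    replace (/ f q p - / g p) with (- (f q p - g p) / (f q p * g p)) by (field; lra).
    unfold Rdiv. rewrite Rabs_mult, Rabs_Ropp, Rabs_inv, (Rabs_pos_eq (f q p * g p)) by nra.
    apply (Rmult_lt_reg_r (f q p * g p)); [nra|].
    rewrite Rmult_assoc, Rinv_l, Rmult_1_r by nra.
    eapply Rlt_le_trans; [exact A|]. apply Rmult_le_compat_l; nra.
Qed.

Lemma bconv_RInt (f : R -> R -> R) (g : R -> R) (a b : R) :
  (forall q x, continuous (f q) x) -> bconv Fl f g ->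
  conv Fl (fun q => RInt (f q) a b) (RInt g a b).
Proof.
  intros Hc [_ U].
  destruct (filterlim_RInt (V := R_CompleteNormedModule) f a b Fl PF g
              (fun q => RInt (f q) a b)) as [I [H1 H2]].
  - intros q. apply (RInt_correct (V := R_CompleteNormedModule)). now apply ex_RInt_cont.
  - apply (filterlim_locally (U := fct_UniformSpace R R_UniformSpace)).
    intros eps. generalize (U eps (cond_pos eps)). apply filter_imp.
    intros q A p. apply A.
  - rewrite (is_RInt_unique _ _ _ _ H2). intros eps He.
    apply (filterlim_locally (U := R_UniformSpace)) with (eps := mkposreal eps He) in H1.
    exact H1.
Qed.

Lemma filter_forall_le (P : nat -> R -> Prop) (N : nat) :
  (forall i, (i <= N)%nat -> Fl (P i)) -> Fl (fun q => forall i, (i <= N)%nat -> P i q).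
Proof.
  induction N as [|N IH]; intros HP.
  - generalize (HP 0%nat (le_n 0)). apply filter_imp. intros q A i Hi.
    now replace i with 0%nat by lia.
  - assert (H1 : Fl (fun q => forall i, (i <= N)%nat -> P i q)) by (apply IH; intros; apply HP; lia).
    generalize (filter_and (F := Fl) _ _ H1 (HP (S N) (le_n _))).
    apply filter_imp. intros q [A B] i Hi.
    destruct (Nat.eq_dec i (S N)) as [->|]; [assumption | apply A; lia].
Qed.

Lemma conv_lipschitz (f : R -> R -> R) (g : R -> R) (M x y : R) :
  (forall q, Rabs (f q x - f q y) <= M * Rabs (x - y)) ->
  conv Fl (fun q => f q x) (g x) -> conv Fl (fun q => f q y) (g y) ->
  Rabs (g x - g y) <= M * Rabs (x - y).
Proof.
  intros HL Hx Hy.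
  replace (g x - g y) with (g x + - g y - 0) by ring.
  apply (conv_bound (fun q => f q x + - f q y)).
  - apply conv_plus; [|apply conv_opp]; assumption.
  - apply filter_forall. intros q. rewrite Rminus_0_r. apply HL.
Qed.

(** As in the Arzela-Ascoli theorem: the limit inherits the Lipschitz constant, and convergence at
    the finitely many points of a fine grid controls all points between them. *)
Lemma equilipschitz_bconv (f : R -> R -> R) (g : R -> R) (M B : R) :
  (forall q p, Rabs (f q p) <= B) ->
  (forall q x y, Rabs (f q x - f q y) <= M * Rabs (x - y)) ->
  (forall q p, f q (clamp p) = f q p) -> (forall p, g (clamp p) = g p) ->
  (forall p, Ip p -> conv Fl (fun q => f q p) (g p)) ->
  bconv Fl f g.
Proof.
  intros HB HL Hf Hg Hc. split; [now exists B|]. intros eps He.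
  assert (HM : 0 <= M).
  { specialize (HL 0 1 0). rewrite Rminus_0_r, Rabs_R1, Rmult_1_r in HL.
    eapply Rle_trans; [apply Rabs_pos | exact HL]. }
  (* With [N = n + 1] grid steps, [N] is positive even if [M = 0], and one step changes each
     function by at most [eps / 4]. Two such changes and the error at the grid point stay below
     [eps]. *)
  destruct (nfloor_ex (4 * M / eps)) as [n [_ Hn]].
  { apply Rdiv_le_0_compat; lra. }
  set (N := S n). assert (HN : 0 < INR N) by (apply lt_0_INR; unfold N; lia).
  assert (HN' : M / INR N <= eps / 4).
  { rewrite <- S_INR in Hn. fold N in Hn.
    apply (Rmult_lt_compat_r eps) in Hn; [|assumption].
    replace (4 * M / eps * eps) with (4 * M) in Hn by (field; lra).
    apply Rmult_le_reg_r with (INR N); [assumption|].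
    replace (M / INR N * INR N) with M by (field; lra). lra. }
  set (x := fun i : nat => -1 + INR i / INR N).
  assert (Hx : forall i, (i <= N)%nat -> Ip (x i)).
  { intros i Hi. apply le_INR in Hi. pose proof (pos_INR i). unfold x, Ip.
    assert (0 <= INR i / INR N) by (apply Rdiv_le_0_compat; lra).
    assert (INR i / INR N <= 1).
    { apply Rmult_le_reg_r with (INR N); [assumption|].
      replace (INR i / INR N * INR N) with (INR i) by (field; lra). lra. }
    lra. }
  assert (A : Fl (fun q => forall i, (i <= N)%nat -> Rabs (f q (x i) - g (x i)) < eps / 4)).
  { apply (filter_forall_le (fun i q => Rabs (f q (x i) - g (x i)) < eps / 4)).
    intros i Hi. apply Hc; [now apply Hx | lra]. }
  generalize A. apply filter_imp. clear A. intros q A p.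
  rewrite <- Hf, <- Hg. pose proof (clamp_Ip p) as Hp. set (y := clamp p) in *. clearbody y.
  destruct (nfloor_ex ((y + 1) * INR N)) as [i [Hi1 Hi2]].
  { apply Rmult_le_pos; [destruct Hp|]; lra. }
  assert (Hi : (i <= N)%nat).
  { apply INR_le. eapply Rle_trans; [exact Hi1|].
    rewrite <- (Rmult_1_l (INR N)) at 2. apply Rmult_le_compat_r; destruct Hp; lra. }
  specialize (A i Hi).
  assert (D : M * Rabs (y - x i) <= eps / 4).
  { apply Rle_trans with (M / INR N); [|assumption]. unfold Rdiv.
    apply Rmult_le_compat_l; [assumption|]. unfold x.
    replace (y - (-1 + INR i / INR N)) with (((y + 1) * INR N - INR i) * / INR N)
      by (field; lra).
    rewrite Rabs_mult, (Rabs_pos_eq (/ INR N)) by (left; now apply Rinv_0_lt_compat).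
    rewrite <- (Rmult_1_l (/ INR N)) at 2. apply Rmult_le_compat_r.
    - left; now apply Rinv_0_lt_compat.
    - rewrite Rabs_pos_eq by lra. lra. }
  assert (L1 := HL q y (x i)).
  assert (L2 : Rabs (g y - g (x i)) <= M * Rabs (y - x i)).
  { apply (conv_lipschitz f); [intros; apply HL | now apply Hc | apply Hc, Hx, Hi]. }
  replace (f q y - g y)
    with ((f q y - f q (x i)) + ((f q (x i) - g (x i)) + - (g y - g (x i)))) by ring.
  eapply Rle_lt_trans; [apply Rabs_triang|].
  assert (T := Rabs_triang (f q (x i) - g (x i)) (- (g y - g (x i)))).
  rewrite Rabs_Ropp in T. lra.
Qed.

(* The difference quotients of f converge and differ from f' by O(step); the step is
   taken towards the middle of [-1, 0] so that the endpoints are covered. *)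
Lemma deriv_pointwise_limit (f f' : R -> R -> R) (g : R -> R) (M : R) :
  (forall q x, -1 < x < 0 -> is_derive (f q) x (f' q x)) ->
  (forall q x, continuous (f q) x) ->
  (forall q x y, Rabs (f' q x - f' q y) <= M * Rabs (x - y)) ->
  (forall p, Ip p -> conv Fl (fun q => f q p) (g p)) ->
  forall p, Ip p -> exists l, conv Fl (fun q => f' q p) l.
Proof.
  intros Hd Hcf HL Hc p Hp.
  assert (HM : 0 <= M).
  { specialize (HL 0 1 0). rewrite Rminus_0_r, Rabs_R1, Rmult_1_r in HL.
    eapply Rle_trans; [apply Rabs_pos | exact HL]. }
  assert (Hex : exists y : R_UniformSpace, filterlim (fun q => f' q p) Fl (locally y)).
  { apply (filterlim_locally_cauchy (U := R_CompleteSpace) (F := Fl)).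
    intros [eps He]. cbn [pos].
    (* The second bound keeps the variation of [f'] over one step below [eps / 4]; the first leaves
       room for the step on at least one side of [p]. *)
    set (d := Rmin (1 / 2) (eps / (4 * (M + 1)))).
    assert (Hd0 : 0 < d) by (apply Rmin_pos; [lra | apply Rdiv_lt_0_compat; lra]).
    assert (Hd1 : d <= 1 / 2) by apply Rmin_l.
    assert (HMd : M * d <= eps / 4).
    { assert (T : d <= eps / (4 * (M + 1))) by apply Rmin_r.
      apply (Rmult_le_compat_l (M + 1)) in T; [|lra].
      replace ((M + 1) * (eps / (4 * (M + 1)))) with (eps / 4) in T by (field; lra). nra. }
    assert (Hs : exists e, Rabs e = d /\ Ip (p + e)).
    { destruct (Rle_dec p (- (1 / 2))); [exists d | exists (- d)];
        rewrite ?Rabs_Ropp, Rabs_pos_eq by lra; unfold Ip in *; (split; [reflexivity | lra]). }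
    destruct Hs as [e [He1 He2]].
    assert (E : 0 < d * eps / 8) by nra.
    assert (Key : forall q, Rabs (f q (p + e) - f q p - f' q p * e) <= d * (eps / 4)).
    { intros q. destruct (MVT_gen (f q) p (p + e) (f' q)) as [z [Hz Ez]].
      - intros x Hx. apply Hd. unfold Ip in *.
        unfold Rmin, Rmax in Hx. destruct Rle_dec; lra.
      - intros x _. apply continuity_pt_filterlim, Hcf.
      - rewrite Ez. replace (f' q z * (p + e - p) - f' q p * e) with (e * (f' q z - f' q p)) by ring.
        rewrite Rabs_mult, He1. apply Rmult_le_compat_l; [lra|].
        eapply Rle_trans; [apply HL|]. apply Rle_trans with (M * d); [|assumption].
        apply Rmult_le_compat_l; [assumption|]. rewrite <- He1.
        unfold Rmin, Rmax in Hz. unfold Rabs.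
        repeat (destruct Rle_dec || destruct Rcase_abs); lra. }
    (* Comparing two values of [q] uses four of these errors and [Key] twice: [4 * (d * eps / 8) + 2
       * (d * eps / 4) = d * eps], which is [eps] after division by the step. *)
    exists (fun q => Rabs (f q (p + e) - g (p + e)) < d * eps / 8 /\ Rabs (f q p - g p) < d * eps / 8).
    split.
    { apply (filter_and (F := Fl)); apply Hc; assumption. }
    intros u v [U1 U2] [V1 V2].
    change (Rabs (f' v p - f' u p) < eps).
    apply Rmult_lt_reg_l with d; [assumption|]. rewrite <- He1 at 1. rewrite <- Rabs_mult.
    pose proof (Key u) as Ku. pose proof (Key v) as Kv.
    apply Rabs_def2 in U1, U2, V1, V2. apply Rabs_le_between in Ku, Kv.
    apply Rabs_def1; nra. }
  destruct Hex as [l Hl]. exists l. intros eps He.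
  apply (filterlim_locally (U := R_UniformSpace)) with (eps := mkposreal eps He) in Hl.
  exact Hl.
Qed.

Context (Fl_shift : forall P, Fl P -> Fl (fun q => forall t, 0 <= t <= 1 -> P (q + t))).

(** The increment of [G] over [q, q + 1] is small, yet it equals a value of [G'] in that interval,
    which is close to [L]. [Fl_shift] makes both estimates available on the whole interval at
    once. *)
Lemma deriv_limit_zero (G G' : R -> R) (l L : R) :
  (forall q, is_derive G q (G' q)) -> conv Fl G l -> conv Fl G' L -> L = 0.
Proof using Fl_shift PF.
  intros Hd HG HG'. destruct (Req_dec L 0) as [|Hn]; [assumption|exfalso].
  assert (He : 0 < Rabs L / 4) by (apply Rdiv_lt_0_compat; [now apply Rabs_pos_lt|lra]).
  destruct (filter_ex _ (filter_and (F := Fl) _ _ (Fl_shift _ (HG _ He)) (Fl_shift _ (HG' _ He))))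
    as [q [A B]].
  destruct (MVT_gen G q (q + 1) G') as [z [Hz E]].
  - intros; apply Hd.
  - intros x _. apply continuity_pt_filterlim. apply (is_derive_continuous _ _ (G' x)), Hd.
  - rewrite Rmin_left, Rmax_right in Hz by lra.
    specialize (B (z - q) ltac:(lra)). replace (q + (z - q)) with z in B by ring.
    pose proof (A 0 ltac:(lra)) as A0. pose proof (A 1 ltac:(lra)) as A1.
    rewrite Rplus_0_r in A0.
    assert (Rabs L <= Rabs (G (q + 1) - l) + Rabs (G q - l) + Rabs (G' z - L)).
    { replace L with ((G (q + 1) - l) + (- (G q - l) + - (G' z - L))) at 1 by lra.
      eapply Rle_trans; [apply Rabs_triang|].
      assert (T := Rabs_triang (- (G q - l)) (- (G' z - L))). rewrite !Rabs_Ropp in T. lra. }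
    lra.
Qed.

(* Landau's interpolation argument: f' differs from a difference quotient by O(step). *)
Lemma deriv_conv_zero (f f' f'' : R -> R) (l M : R) :
  (forall q, is_derive f q (f' q)) -> (forall q, is_derive f' q (f'' q)) ->
  (forall q, Rabs (f'' q) <= M) -> conv Fl f l -> conv Fl f' 0.
Proof using Fl_shift PF.
  intros Hd Hd' HM Hf eps He.
  assert (HM0 : 0 <= M) by (eapply Rle_trans; [apply Rabs_pos | apply (HM 0)]).
  (* The step is at most 1 because [Fl_shift] covers only such shifts; the other bound makes [f']
     vary by at most [eps / 2] over a step. *)
  set (d := Rmin 1 (eps / (2 * (M + 1)))).
  assert (Hd0 : 0 < d) by (apply Rmin_pos; [lra | apply Rdiv_lt_0_compat; lra]).
  assert (Hd1 : d <= 1) by apply Rmin_l.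
  assert (HMd : M * d <= eps / 2).
  { assert (T : d <= eps / (2 * (M + 1))) by apply Rmin_r.
    apply (Rmult_le_compat_l (M + 1)) in T; [|lra].
    replace ((M + 1) * (eps / (2 * (M + 1)))) with (eps / 2) in T by (field; lra). nra. }
  assert (E : 0 < d * eps / 4) by (apply Rdiv_lt_0_compat; nra).
  generalize (Fl_shift _ (Hf _ E)). apply filter_imp. intros q A.
  pose proof (A 0 ltac:(lra)) as A0. pose proof (A d ltac:(lra)) as A1. rewrite Rplus_0_r in A0.
  destruct (MVT_gen f q (q + d) f') as [z [Hz Ez]].
  { intros; apply Hd. }
  { intros x _. apply continuity_pt_filterlim. apply (is_derive_continuous _ _ (f' x)), Hd. }
  rewrite Rmin_left, Rmax_right in Hz by lra.
  destruct (MVT_gen f' q z f'') as [y [Hy Ey]].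
  { intros; apply Hd'. }
  { intros x _. apply continuity_pt_filterlim. apply (is_derive_continuous _ _ (f'' x)), Hd'. }
  rewrite Rminus_0_r.
  assert (B1 : Rabs (f' z - f' q) <= eps / 2).
  { rewrite Ey, Rabs_mult, (Rabs_pos_eq (z - q)) by lra.
    apply Rle_trans with (M * d); [|assumption].
    apply Rmult_le_compat; [apply Rabs_pos | lra | apply HM | lra]. }
  assert (B2 : d * Rabs (f' z) < d * (eps / 2)).
  { rewrite <- (Rabs_pos_eq d) at 1 by lra. rewrite <- Rabs_mult.
    replace (d * f' z) with ((f (q + d) - l) + - (f q - l)) by (rewrite Rmult_comm; lra).
    eapply Rle_lt_trans; [apply Rabs_triang|]. rewrite Rabs_Ropp. lra. }
  apply Rmult_lt_reg_l in B2; [|assumption].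
  replace (f' q) with (f' z + - (f' z - f' q)) by ring.
  eapply Rle_lt_trans; [apply Rabs_triang|]. rewrite Rabs_Ropp. lra.
Qed.

End Filters.

(** * Differentiation rules *)

Lemma is_derive_plus_R (f g : R -> R) (x a b : R) :
  is_derive f x a -> is_derive g x b -> is_derive (fun y => f y + g y) x (a + b).
Proof. intros; now apply (is_derive_plus (V := R_NormedModule) f g). Qed.

Lemma is_derive_minus_R (f g : R -> R) (x a b : R) :
  is_derive f x a -> is_derive g x b -> is_derive (fun y => f y - g y) x (a - b).
Proof. intros; now apply (is_derive_minus (V := R_NormedModule) f g). Qed.

Lemma is_derive_opp_R (f : R -> R) (x a : R) :
  is_derive f x a -> is_derive (fun y => - f y) x (- a).
Proof. intros; now apply (is_derive_opp (V := R_NormedModule) f). Qed.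

Lemma is_derive_mult_R (f g : R -> R) (x a b : R) :
  is_derive f x a -> is_derive g x b -> is_derive (fun y => f y * g y) x (a * g x + f x * b).
Proof. intros Hf Hg. apply (is_derive_mult f g x a b Hf Hg). apply Rmult_comm. Qed.

Lemma is_derive_inv_R (f : R -> R) (x a : R) :
  is_derive f x a -> f x <> 0 -> is_derive (fun y => / f y) x (- a / f x ^ 2).
Proof. intros; now apply is_derive_inv. Qed.

Lemma is_derive_const_R (c x : R) : is_derive (fun _ : R => c) x 0.
Proof. apply (is_derive_const (V := R_NormedModule)). Qed.

Lemma is_derive_eq (f : R -> R) (x l l' : R) : is_derive f x l -> l = l' -> is_derive f x l'.
Proof. now intros Hf <-. Qed.

Ltac der :=
  lazymatch goal with
  | |- is_derive (fun _ => ?c) _ _ => apply is_derive_const_R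
  | |- is_derive (fun _ => _ + _) _ _ => eapply is_derive_plus_R; der
  | |- is_derive (fun _ => _ - _) _ _ => eapply is_derive_minus_R; der
  | |- is_derive (fun _ => - _) _ _ => eapply is_derive_opp_R; der
  | |- is_derive (fun _ => _ * _) _ _ => eapply is_derive_mult_R; der
  | |- is_derive (fun _ => / _) _ _ => eapply is_derive_inv_R; [der |]
  | |- is_derive _ _ _ => eassumption
  end.

(** * Conjugate flows *)

Section ConjugateFlow.

Context (sig sig' H H' K k : R -> R) (c e : R).
Context (Csig : forall x, continuous sig x) (Csig' : forall x, continuous sig' x)
  (CH : forall x, continuous H x) (CH' : forall x, continuous H' x)
  (CK : forall x, continuous K x) (Ck : forall x, continuous k x).
Context (c_pos : 0 < c) (H'_ge : forall x, c <= H' x) (k_ge : forall x, c <= k x).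
Context (Dsig : forall x, -1 < x < 0 -> is_derive sig x (sig' x))
  (DH : forall x, -1 < x < 0 -> is_derive H x (H' x))
  (DK : forall x, -1 < x < 0 -> is_derive K x (k x)).
Context (sig_top : 0 <= sig 0) (sig'_neg : forall x, Ip x -> sig' x <= 0).
Context (bottom : K (-1) = H (-1)).

Let A (x : R) : R := - / 2 * (/ k x * / k x) + / 2 * (/ H' x * / H' x).
(** The term [- / H' x] normalises the flow force: the density is identically zero when [K = H] and
    [k = H']. *)
Let s (x : R) : R :=
  / 2 * / k x + / 2 * k x * (/ H' x * / H' x) - / H' x - sig x * (K x - H x) * (k x - H' x).

Context (top : A 0 = sig 0 * (K 0 - H 0))
  (weak : forall x, Ip x -> A 0 - A x = RInt (fun y => sig' y * (K y - H y)) x 0)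
  (flow : RInt s (-1) 0 = 0).
Context (e_sign : e = 1 \/ e = -1) (ordered : forall x, Ip x -> 0 <= e * (K x - H x)).

Let kpos x : 0 < k x.
Proof. specialize (k_ge x); lra. Qed.
Let Hpos x : 0 < H' x.
Proof. specialize (H'_ge x); lra. Qed.

Lemma continuous_forcing x : continuous (fun y => sig' y * (K y - H y)) x.
Proof using Csig' CH CK. pose proof (Csig' x). pose proof (CH x). pose proof (CK x). cont1. Qed.

(** By [weak] and [top], [A x] is [sig 0 * (K 0 - H 0)] minus the integral of [sig' * (K - H)].
    Since [sig 0 >= 0] and [sig' <= 0], both contributions have the sign [e]. As a difference of
    squares of reciprocals, [A x] is [k x - H' x] times a positive factor. *)
Lemma slopes_ordered x : Ip x -> 0 <= e * (k x - H' x).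
Proof using All.
  intros Hx.
  assert (HA : 0 <= e * A x).
  { replace (A x) with (A 0 - RInt (fun y => sig' y * (K y - H y)) x 0)
      by (rewrite <- weak by assumption; ring).
    rewrite top.
    assert (T1 : 0 <= sig 0 * (e * (K 0 - H 0))).
    { apply Rmult_le_pos; [assumption|]. apply ordered. unfold Ip; lra. }
    assert (T2 : 0 <= RInt (fun y => scal (- e) (sig' y * (K y - H y))) x 0).
    { unfold Ip in Hx. apply RInt_ge_0; [lra| |].
      - apply (ex_RInt_scal (V := R_NormedModule)).
        apply ex_RInt_cont, continuous_forcing.
      - intros y Hy. unfold scal; simpl; unfold mult; simpl.
        assert (0 <= e * (K y - H y)) by (apply ordered; unfold Ip; lra).
        assert (sig' y <= 0) by (apply sig'_neg; unfold Ip; lra). nra. }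
    rewrite (RInt_scal (V := R_CompleteNormedModule)) in T2
      by apply ex_RInt_cont, continuous_forcing.
    unfold scal in T2; simpl in T2; unfold mult in T2; simpl in T2. nra. }
  pose proof (kpos x) as P1. pose proof (Hpos x) as P2.
  assert (E : A x = (k x - H' x) * ((k x + H' x) * / 2 * (/ k x * / k x) * (/ H' x * / H' x)))
    by (unfold A; field; lra).
  assert (Q1 := Rinv_0_lt_compat _ P1). assert (Q2 := Rinv_0_lt_compat _ P2).
  rewrite E, <- Rmult_assoc in HA.
  apply Rmult_le_reg_r with ((k x + H' x) * / 2 * (/ k x * / k x) * (/ H' x * / H' x));
    [|now rewrite Rmult_0_l].
  repeat apply Rmult_lt_0_compat; lra.
Qed.

(* With W = K - H, the function A W - sig W^2 vanishes at both ends, and its derivative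
   minus twice the flow-force density is - W'^3 / (2 K'^2 H'^2). *)
Lemma slope_cube_zero x : -1 < x < 0 -> k x = H' x.
Proof using All.
  intros Hx.
  set (f := fun y => e * ((k y - H' y) * (k y - H' y) * (k y - H' y))
                     * (/ 2 * (/ k y * / k y) * (/ H' y * / H' y))).
  (* [k] is only known to be continuous, so [A] cannot be differentiated directly. [B] agrees with
     [A] on [-1, 0] and is differentiable as a primitive; the explicit formula of [A] is put back
     after differentiation. *)
  set (B := fun y => A 0 + RInt (fun y => sig' y * (K y - H y)) 0 y).
  (* The factor [- e] makes the derivative equal to [f], which is nonnegative by
     [slopes_ordered]. *)
  set (G := fun y => - e * (B y * (K y - H y) - sig y * ((K y - H y) * (K y - H y))
                            - 2 * RInt s (-1) y)).
  assert (Cs : forall y, continuous s y).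
  { intros y. pose proof (Csig y). pose proof (CH y). pose proof (CK y).
    pose proof (CH' y). pose proof (Ck y). pose proof (kpos y). pose proof (Hpos y).
    unfold s. cont1; lra. }
  assert (Cf : forall y, continuous f y).
  { intros y. pose proof (CH' y). pose proof (Ck y). pose proof (kpos y). pose proof (Hpos y).
    unfold f. cont1; lra. }
  assert (BA : forall y, Ip y -> B y = A y).
  { intros y Hy. unfold B. specialize (weak y Hy).
    assert (T := opp_RInt_swap (V := R_CompleteNormedModule)
                   (fun y => sig' y * (K y - H y)) y 0
                   (ex_RInt_cont _ _ _ continuous_forcing)).
    unfold opp in T; simpl in T. lra. }
  assert (DB : forall y, is_derive B y (0 + sig' y * (K y - H y))).
  { intros y. apply is_derive_plus_R; [apply is_derive_const_R|].
    apply (is_derive_RInt_cont (fun y => sig' y * (K y - H y))), continuous_forcing. }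
  assert (Ds : forall y, is_derive (fun z => RInt s (-1) z) y (s y)).
  { intros y. now apply is_derive_RInt_cont. }
  assert (If : RInt f (-1) 0 = 0).
  { rewrite (FTC_open G f); [| lra | | |assumption].
    - unfold G. rewrite bottom, flow, RInt_point, !BA by (unfold Ip; lra).
      rewrite top. unfold zero; simpl. ring.
    - intros y Hy. specialize (DB y). specialize (Ds y). specialize (Dsig y Hy).
      specialize (DH y Hy). specialize (DK y Hy). unfold G.
      eapply is_derive_eq; [der|]. rewrite BA by (unfold Ip; lra).
      pose proof (kpos y). pose proof (Hpos y). unfold A, s, f.
      destruct e_sign as [-> | ->]; field; lra.
    - intros y. pose proof (Csig y). pose proof (CH y). pose proof (CK y).
      pose proof (is_derive_continuous _ _ _ (DB y)).
      pose proof (is_derive_continuous _ _ _ (Ds y)).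
      unfold G. cont1. }
  pose proof (kpos x) as P1. pose proof (Hpos x) as P2.
  assert (Hf : f x = 0).
  { apply (RInt_zero_nonneg f (-1) 0); [assumption| |assumption|assumption].
    intros y Hy. assert (S := slopes_ordered y ltac:(unfold Ip; lra)).
    pose proof (kpos y) as R1. pose proof (Hpos y) as R2.
    apply Rinv_0_lt_compat in R1, R2. unfold f. apply Rmult_le_pos.
    - replace (e * ((k y - H' y) * (k y - H' y) * (k y - H' y)))
        with ((e * (k y - H' y)) * ((k y - H' y) * (k y - H' y))) by ring.
      apply Rmult_le_pos; [assumption|]. apply Rle_0_sqr.
    - left. repeat apply Rmult_lt_0_compat; lra. }
  apply Rinv_0_lt_compat in P1, P2. unfold f in Hf.
  apply Rmult_integral in Hf. destruct Hf as [Hf|Hf].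
  - apply Rmult_integral in Hf. destruct Hf as [Hf|Hf]; [lra|].
    apply Rmult_integral in Hf. destruct Hf as [Hf|Hf]; [|lra].
    apply Rmult_integral in Hf. lra.
  - exfalso. revert Hf. apply Rgt_not_eq. unfold Rgt.
    repeat apply Rmult_lt_0_compat; lra.
Qed.

Lemma conjugate_flow_unique x : Ip x -> K x = H x.
Proof using All.
  intros [Hx1 Hx2].
  assert (E : RInt (fun _ => 0) (-1) x = (K x - H x) - (K (-1) - H (-1))).
  { apply (FTC_open (fun y => K y - H y)); [assumption| | |intros; apply continuous_const].
    - intros y Hy. eapply is_derive_eq.
      + apply is_derive_minus_R; [apply DK | apply DH]; lra.
      + rewrite slope_cube_zero by lra. ring.
    - intros y. now apply continuous_minus_R. }
  rewrite RInt_const in E. unfold scal in E; simpl in E; unfold mult in E; simpl in E. lra.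
Qed.

End ConjugateFlow.

(** * Continuity in two variables and integrals with a parameter *)

Lemma continuity_2d_pt_section (f : R -> R -> R) (q p : R) :
  continuity_2d_pt f q p -> continuous (f q) p.
Proof.
  intros Hf. apply (filterlim_locally (U := R_UniformSpace)). intros eps.
  destruct (Hf eps) as [d Hd]. exists d. intros y Hy.
  apply (Hd q y); [|exact Hy]. rewrite Rminus_diag, Rabs_R0. apply cond_pos.
Qed.

Lemma continuity_2d_pt_lift (f : R -> R) (q p : R) :
  continuous f p -> continuity_2d_pt (fun _ v => f v) q p.
Proof.
  intros Hf. apply (continuity_1d_2d_pt_comp f (fun _ v => v)).
  - now apply continuity_pt_filterlim.
  - apply continuity_2d_pt_id2.
Qed.

Lemma lipschitz_continuous (f : R -> R) (M x : R) :
  (forall x y, Rabs (f x - f y) <= M * Rabs (x - y)) -> continuous f x.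
Proof.
  intros HL. apply (filterlim_locally (U := R_UniformSpace)). intros [eps He].
  assert (HM : 0 <= M).
  { specialize (HL 0 1). replace (Rabs (0 - 1)) with 1 in HL by (rewrite Rabs_left; lra).
    rewrite Rmult_1_r in HL. eapply Rle_trans; [apply Rabs_pos | exact HL]. }
  assert (Hd : 0 < eps / (M + 1)) by (apply Rdiv_lt_0_compat; lra).
  exists (mkposreal _ Hd). intros y Hy. change (Rabs (y - x) < eps / (M + 1)) in Hy.
  change (Rabs (f y - f x) < eps). eapply Rle_lt_trans; [apply HL|].
  apply Rle_lt_trans with ((M + 1) * Rabs (y - x)).
  - apply Rmult_le_compat_r; [apply Rabs_pos | lra].
  - apply (Rmult_lt_compat_l (M + 1)) in Hy; [|lra].
    replace ((M + 1) * (eps / (M + 1))) with eps in Hy by (field; lra). lra.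
Qed.

Lemma is_derive_RInt_param_cont (f f' : R -> R -> R) (a b q : R) :
  (forall q p, is_derive (fun u => f u p) q (f' q p)) ->
  (forall q p, continuous (f q) p) -> (forall q p, continuity_2d_pt f' q p) ->
  is_derive (fun u => RInt (f u) a b) q (RInt (f' q) a b).
Proof.
  intros Hd Hf Hf'.
  assert (E : forall u p, Derive (fun z => f z p) u = f' u p)
    by (intros; now apply is_derive_unique).
  rewrite <- (RInt_ext (fun p => Derive (fun z => f z p) q)) by (intros; apply E).
  apply (is_derive_RInt_param f a b q).
  - apply filter_forall. intros u p _. now exists (f' u p).
  - intros p _. apply (continuity_2d_pt_ext f'); [intros; now rewrite E | apply Hf'].
  - apply filter_forall. intros u. apply ex_RInt_cont, Hf.
Qed.

Lemma bconv_ext (Fl : (R -> Prop) -> Prop) {PF : ProperFilter Fl} (f : R -> R -> R) (g g' : R -> R) :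
  (forall p, g p = g' p) -> bconv Fl f g -> bconv Fl f g'.
Proof. intros E [B U]. split; [assumption|]. intros eps He. generalize (U eps He). apply filter_imp.
  intros q A p. rewrite <- E. apply A.
Qed.

(** * Flow force and far-field limits *)

Section Strip.

Context (sig sig' H H' : R -> R) (h hq hp hqq hqp hpq : R -> R -> R) (c M : R).
Context (Csig : forall x, continuous sig x) (Csig' : forall x, continuous sig' x)
  (CH : forall x, continuous H x) (CH' : forall x, continuous H' x).
Context (Ch : forall q p, continuity_2d_pt h q p)
  (Chq : forall q p, continuity_2d_pt hq q p)
  (Chp : forall q p, continuity_2d_pt hp q p)
  (Chqq : forall q p, continuity_2d_pt hqq q p)
  (Chpq : forall q p, continuity_2d_pt hpq q p).
Context (c_pos : 0 < c) (H'_ge : forall x, c <= H' x) (hp_ge : forall q p, c <= hp q p).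
Context (Dsig : forall x, -1 < x < 0 -> is_derive sig x (sig' x))
  (DH : forall x, -1 < x < 0 -> is_derive H x (H' x)).
Context (Dhq : forall q p, is_derive (fun u => h u p) q (hq q p))
  (Dhqq : forall q p, is_derive (fun u => hq u p) q (hqq q p))
  (Dhpq : forall q p, is_derive (fun u => hp u p) q (hpq q p))
  (Dhp : forall q p, -1 < p < 0 -> is_derive (h q) p (hp q p))
  (Dhqp : forall q p, -1 < p < 0 -> is_derive (hq q) p (hqp q p)).
Context (Bsig : forall x, Rabs (sig x) <= M) (Bsig' : forall x, Rabs (sig' x) <= M)
  (BH : forall x, Rabs (H x) <= M) (BH' : forall x, Rabs (H' x) <= M)
  (Bh : forall q p, Rabs (h q p) <= M) (Bhq : forall q p, Rabs (hq q p) <= M)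
  (Bhp : forall q p, Rabs (hp q p) <= M) (Bhqq : forall q p, Rabs (hqq q p) <= M).
Context (Lh : forall q x y, Rabs (h q x - h q y) <= M * Rabs (x - y))
  (Lhq : forall q x y, Rabs (hq q x - hq q y) <= M * Rabs (x - y))
  (Lhp : forall q x y, Rabs (hp q x - hp q y) <= M * Rabs (x - y)).
Context (Kh : forall q p, h q (clamp p) = h q p)
  (Khq : forall q p, hq q (clamp p) = hq q p)
  (Khp : forall q p, hp q (clamp p) = hp q p).

Let A (q p : R) : R :=
  - / 2 * ((1 + hq q p * hq q p) * (/ hp q p * / hp q p)) + / 2 * (/ H' p * / H' p).
Let s (q p : R) : R :=
  / 2 * ((1 - hq q p * hq q p) * / hp q p) + / 2 * hp q p * (/ H' p * / H' p) - / H' p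
  - sig p * (h q p - H p) * (hp q p - H' p).
(** The q-derivative of [s]. *)
Let sq (q p : R) : R :=
  / 2 * (- (2 * hq q p * hqq q p) * / hp q p
         - (1 - hq q p * hq q p) * hpq q p * (/ hp q p * / hp q p))
  + / 2 * hpq q p * (/ H' p * / H' p)
  - sig p * (hq q p * (hp q p - H' p) + (h q p - H p) * hpq q p).
(** The q-derivative of the horizontal flux [hq / hp]. *)
Let J (q p : R) : R := hqq q p * / hp q p - hq q p * hpq q p * (/ hp q p * / hp q p).

Context (interior : forall q p, -1 < p < 0 ->
    is_derive (A q) p (- J q p + sig' p * (h q p - H p)))
  (top : forall q, A q 0 = sig 0 * (h q 0 - H 0))
  (bottom_h : forall q, h q (-1) = 0) (bottom_H : H (-1) = 0).

Let hpos q p : 0 < hp q p.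
Proof. specialize (hp_ge q p); lra. Qed.
Let Hpos p : 0 < H' p.
Proof. specialize (H'_ge p); lra. Qed.

Ltac facts q p :=
  pose proof (Ch q p); pose proof (Chq q p); pose proof (Chp q p); pose proof (Chqq q p);
  pose proof (Chpq q p);
  pose proof (continuity_2d_pt_lift _ q p (Csig p));
  pose proof (continuity_2d_pt_lift _ q p (Csig' p));
  pose proof (continuity_2d_pt_lift _ q p (CH p));
  pose proof (continuity_2d_pt_lift _ q p (CH' p));
  pose proof (hpos q p); pose proof (Hpos p).

Lemma cont2_A q p : continuity_2d_pt A q p.
Proof using All. facts q p. unfold A. cont2; lra. Qed.

Lemma cont2_s q p : continuity_2d_pt s q p.
Proof using All. facts q p. unfold s. cont2; lra. Qed.

Lemma cont2_sq q p : continuity_2d_pt sq q p.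
Proof using All. facts q p. unfold sq. cont2; lra. Qed.

Lemma cont2_J q p : continuity_2d_pt J q p.
Proof using All. facts q p. unfold J. cont2; lra. Qed.

Lemma cont2_forcing q p : continuity_2d_pt (fun q p => sig' p * (h q p - H p)) q p.
Proof using All. facts q p. cont2. Qed.

Lemma bottom_hq q : hq q (-1) = 0.
Proof using Dhq bottom_h.
  rewrite <- (is_derive_unique _ _ _ (Dhq q (-1))).
  rewrite (Derive_ext _ (fun _ => 0)) by (intros; apply bottom_h). apply Derive_const.
Qed.

(** Since [h] vanishes on the bed, it is the integral of [hp] from there. Differentiating under the
    integral represents [hq] as the integral of [hpq], and the fundamental theorem differentiates
    this in [p]. *)
Lemma mixed_partials q p : -1 < p < 0 -> hqp q p = hpq q p.
Proof using Ch Chp Chpq Dhp Dhpq Dhq Dhqp bottom_h.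
  intros Hp.
  assert (E : forall x, -1 < x < 0 -> hq q x = RInt (hpq q) (-1) x).
  { intros x Hx. rewrite <- (is_derive_unique _ _ _ (Dhq q x)).
    rewrite (Derive_ext _ (fun u => RInt (hp u) (-1) x)).
    - apply is_derive_unique, is_derive_RInt_param_cont; try assumption.
      intros; now apply continuity_2d_pt_section.
    - intros u. rewrite (FTC_open (h u) (hp u)); [rewrite bottom_h; ring | lra | | | ].
      + intros; apply Dhp; lra.
      + intros; now apply continuity_2d_pt_section.
      + intros; now apply continuity_2d_pt_section. }
  rewrite <- (is_derive_unique _ _ _ (Dhqp q p Hp)). apply is_derive_unique.
  apply (is_derive_ext_loc (V := R_NormedModule) (fun x => RInt (hpq q) (-1) x)).
  - apply (locally_interval _ p (-1) 0); simpl; try lra.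
    intros y Hy1 Hy2. symmetry. apply E. lra.
  - apply is_derive_RInt_cont. intros; now apply continuity_2d_pt_section.
Qed.

Lemma flow_force_constant q1 q2 : RInt (s q1) (-1) 0 = RInt (s q2) (-1) 0.
Proof using All.
  assert (D : forall q, is_derive (fun u => RInt (s u) (-1) 0) q 0).
  { intros q.
    assert (Z : RInt (sq q) (-1) 0 = 0).
    { rewrite (FTC_open (fun p => (A q p - sig p * (h q p - H p)) * hq q p) (sq q)).
      (* The surface condition kills the first factor at [p = 0], and [hq] vanishes at [p = -1]. *)
      - rewrite top, bottom_hq. lra.
      - lra.
      - intros p Hp. pose proof (interior q p Hp) as D1. pose proof (Dsig p Hp) as D2.
        pose proof (DH p Hp) as D3. pose proof (Dhp q p Hp) as D4. pose proof (Dhqp q p Hp) as D5.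
        (* The forcing [sig' * (h - H)] from the interior equation cancels the term in which [sig]
           is differentiated. Replacing [hqp] by [hpq] then leaves exactly [sq]. *)
        eapply is_derive_eq; [der|]. rewrite (mixed_partials q p Hp).
        pose proof (hpos q p). pose proof (Hpos p). unfold A, J, sq. field. lra.
      - intros p. pose proof (continuity_2d_pt_section _ _ _ (cont2_A q p)).
        pose proof (continuity_2d_pt_section _ _ _ (Ch q p)).
        pose proof (continuity_2d_pt_section _ _ _ (Chq q p)).
        pose proof (Csig p). pose proof (CH p). cont1.
      - intros p. apply continuity_2d_pt_section, cont2_sq. }
    apply (is_derive_eq _ _ (RInt (sq q) (-1) 0)); [|exact Z].
    apply is_derive_RInt_param_cont.
    - intros u p. pose proof (Dhq u p) as D1. pose proof (Dhqq u p) as D2.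
      pose proof (Dhpq u p) as D3. pose proof (hpos u p). pose proof (Hpos p). unfold s.
      eapply is_derive_eq; [der; lra|]. unfold sq. field. lra.
    - intros; apply continuity_2d_pt_section, cont2_s.
    - intros; apply cont2_sq. }
  assert (forall a b, a < b -> RInt (s a) (-1) 0 = RInt (s b) (-1) 0) as W.
  { intros a b Hab. apply (eq_is_derive (V := R_NormedModule) (fun u => RInt (s u) (-1) 0)); auto. }
  destruct (Rtotal_order q1 q2) as [L | [-> | L]]; [now apply W | reflexivity | symmetry; now apply W].
Qed.

(** Integrating the interior equation in [p] trades the p-derivative of [A] for boundary values. The
    right-hand side then contains only [h] and its first derivatives, whose limits are available. *)
Lemma horizontal_flux_derive p0 q : Ip p0 ->
  is_derive (fun u => RInt (fun p => hq u p * / hp u p) p0 0) q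
    (RInt (fun p => sig' p * (h q p - H p)) p0 0 + (A q p0 + - A q 0)).
Proof using All.
  intros [Hp1 Hp2].
  assert (X1 : forall p, continuous (fun p => sig' p * (h q p - H p)) p)
    by (intros; apply (continuity_2d_pt_section (fun q p => sig' p * (h q p - H p))), cont2_forcing).
  assert (X2 : forall p, continuous (J q) p)
    by (intros; apply continuity_2d_pt_section, cont2_J).
  assert (X3 : forall p, continuous (fun p => - J q p + sig' p * (h q p - H p)) p)
    by (intros; apply continuous_plus_R; [apply continuous_opp_R|]; auto).
  assert (E : RInt (J q) p0 0
              = RInt (fun p => sig' p * (h q p - H p)) p0 0 + (A q p0 + - A q 0)).
  { rewrite (RInt_ext (J q) (fun p => minus (sig' p * (h q p - H p))
                                        (- J q p + sig' p * (h q p - H p)))).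
    - rewrite (RInt_minus (V := R_CompleteNormedModule)) by now apply ex_RInt_cont.
      rewrite (FTC_open (A q) (fun p => - J q p + sig' p * (h q p - H p))); [| lra | | |assumption].
      + unfold minus, plus, opp; simpl. lra.
      + intros; apply interior; lra.
      + intros; apply continuity_2d_pt_section, cont2_A.
    - intros. unfold minus, plus, opp; simpl. ring. }
  rewrite <- E. apply is_derive_RInt_param_cont.
  - intros u p. pose proof (Dhqq u p) as D2. pose proof (Dhpq u p) as D3.
    pose proof (hpos u p). eapply is_derive_eq; [der; lra|]. unfold J. field. lra.
  - intros u p. apply (continuity_2d_pt_section (fun u p => hq u p * / hp u p)).
    facts u p. cont2. lra.
  - intros; apply cont2_J.
Qed.

Section Limit.

Context (Fl : (R -> Prop) -> Prop) {PF : ProperFilter Fl}.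
Context (Fl_shift : forall P, Fl P -> Fl (fun q => forall t, 0 <= t <= 1 -> P (q + t))).
Context (K : R -> R) (KK : forall p, K (clamp p) = K p)
  (limit : forall p, Ip p -> conv Fl (fun q => h q p) (K p)).

(** The Lipschitz bounds in [p] upgrade pointwise limits of [h], [hq] and [hp] to [bconv], which is
    preserved by the algebra building [A] and [s] and by integration. Each property of the profile
    is then the limit of an identity valid for every [q]. *)
Lemma limit_profile : exists k : R -> R,
  (forall x, continuous K x) /\ (forall x, continuous k x) /\ (forall x, c <= k x) /\
  (forall x, -1 < x < 0 -> is_derive K x (k x)) /\ K (-1) = 0 /\
  - / 2 * (/ k 0 * / k 0) + / 2 * (/ H' 0 * / H' 0) = sig 0 * (K 0 - H 0) /\
  (forall x, Ip x ->
    - / 2 * (/ k 0 * / k 0) + / 2 * (/ H' 0 * / H' 0)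
    - (- / 2 * (/ k x * / k x) + / 2 * (/ H' x * / H' x))
    = RInt (fun y => sig' y * (K y - H y)) x 0) /\
  forall q, RInt (s q) (-1) 0
    = RInt (fun x => / 2 * / k x + / 2 * k x * (/ H' x * / H' x) - / H' x
                     - sig x * (K x - H x) * (k x - H' x)) (-1) 0.
Proof using All.
  (* Clamping [p] provides a limit for every real argument, as the choice of a function on the line
     requires. *)
  assert (Ex : forall p, exists l, conv Fl (fun q => hp q (clamp p)) l).
  { intros p. apply (deriv_pointwise_limit Fl h hp K M); auto using clamp_Ip.
    intros; now apply continuity_2d_pt_section. }
  apply functional_choice in Ex. destruct Ex as [k0 Hk0].
  set (k := fun p => k0 (clamp p)).
  assert (Hk : forall p, conv Fl (fun q => hp q p) (k p)).
  { intros p eps He. generalize (Hk0 (clamp p) eps He). apply filter_imp. intros q.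
    rewrite (clamp_id (clamp p)), Khp by apply clamp_Ip. auto. }
  assert (Hk' : forall p, k (clamp p) = k p).
  { intros p. unfold k. now rewrite (clamp_id (clamp p)) by apply clamp_Ip. }
  assert (HK : forall p, conv Fl (fun q => h q p) (K p)).
  { intros p eps He. generalize (limit (clamp p) (clamp_Ip p) eps He).
    apply filter_imp. intros q. now rewrite Kh, KK. }
  assert (Bp : bconv Fl hp k) by (apply (equilipschitz_bconv Fl hp k M M); auto).
  assert (B0 : bconv Fl h K) by (apply (equilipschitz_bconv Fl h K M M); auto).
  assert (Bq : bconv Fl hq (fun _ => 0)).
  { apply (equilipschitz_bconv Fl hq (fun _ => 0) M M); auto.
    intros p _. apply (deriv_conv_zero Fl Fl_shift (fun q => h q p) _ (fun q => hqq q p) (K p) M);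
      auto. }
  assert (Bi : bconv Fl (fun q p => / hp q p) (fun p => / k p))
    by (apply (bconv_inv Fl hp k c); auto).
  assert (B1 : bconv Fl (fun _ => sig) sig) by now apply bconv_const with M.
  assert (B1' : bconv Fl (fun _ => sig') sig') by now apply bconv_const with M.
  assert (B2 : bconv Fl (fun _ => H) H) by now apply bconv_const with M.
  assert (B2' : bconv Fl (fun _ => H') H') by now apply bconv_const with M.
  assert (B3 : bconv Fl (fun _ p => / H' p) (fun p => / H' p))
    by (apply (bconv_inv Fl (fun _ => H') H' c); auto).
  assert (Bc : forall a, bconv Fl (fun _ _ => a) (fun _ => a)).
  { intros a. apply (bconv_const Fl (fun _ => a) (Rabs a)). intros; lra. }
  assert (BA : bconv Fl A (fun x => - / 2 * (/ k x * / k x) + / 2 * (/ H' x * / H' x))).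
  (* The limit is written with [0] in place of [hq], so that it has the shape of [A] and the closure
     rules apply term by term. *)
  { apply (bconv_ext Fl A (fun x => - / 2 * ((1 + 0 * 0) * (/ k x * / k x)) + / 2 * (/ H' x * / H' x))).
    - intros. ring.
    - repeat first [assumption | apply bconv_plus | apply bconv_mult | apply Bc]. }
  assert (Bs : bconv Fl s (fun x => / 2 * / k x + / 2 * k x * (/ H' x * / H' x) - / H' x
                     - sig x * (K x - H x) * (k x - H' x))).
  { apply (bconv_ext Fl s (fun x => / 2 * ((1 - 0 * 0) * / k x) + / 2 * k x * (/ H' x * / H' x)
                     - / H' x - sig x * (K x - H x) * (k x - H' x))).
    - intros. ring.
    - repeat first [assumption | apply bconv_minus | apply bconv_plus | apply bconv_mult | apply Bc]. }
  assert (CK : forall x, continuous K x).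
  { intros x. apply (lipschitz_continuous K M). intros a b.
    apply (conv_lipschitz Fl h); auto. }
  assert (Ck : forall x, continuous k x).
  { intros x. apply (lipschitz_continuous k M). intros a b.
    apply (conv_lipschitz Fl hp); auto. }
  assert (Km1 : K (-1) = 0).
  { apply (conv_unique Fl (fun q => h q (-1))); [apply HK|].
    intros eps He. apply filter_forall. intros q. rewrite bottom_h, Rminus_diag, Rabs_R0.
    assumption. }
  exists k. split; [assumption|]. split; [assumption|].
  split; [|split; [|split; [assumption|split; [|split]]]].
  - apply (bconv_ge Fl hp k c); auto.
  - intros x Hx.
    (* Passing to the limit in [h q y = RInt (hp q) (-1) y] identifies [K] with the primitive of
       [k]. *)
    apply (is_derive_ext_loc (V := R_NormedModule) (fun y => RInt k (-1) y)).
    + apply (locally_interval _ x (-1) 0); simpl; try lra.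
      intros y Hy1 Hy2. symmetry. apply (conv_unique Fl (fun q => h q y)); [apply HK|].
      intros eps He.
      generalize (bconv_RInt Fl hp k (-1) y
        (fun q x => continuity_2d_pt_section _ _ _ (Chp q x)) Bp eps He).
      apply filter_imp. intros q.
      rewrite (FTC_open (h q) (hp q)), bottom_h, Rminus_0_r; auto; try lra.
      * intros; apply Dhp; lra.
      * intros; now apply continuity_2d_pt_section.
      * intros; now apply continuity_2d_pt_section.
    + now apply is_derive_RInt_cont.
  - apply (conv_unique Fl (fun q => A q 0)); [apply (bconv_conv Fl A _ 0 BA)|].
    intros eps He.
    assert (B : bconv Fl (fun q p => sig p * (h q p - H p)) (fun p => sig p * (K p - H p))).
    { apply (bconv_mult Fl); [|apply (bconv_minus Fl)]; assumption. }
    generalize (bconv_conv _ _ _ 0 B eps He). apply filter_imp. intros q. now rewrite top.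
  - intros x Hx.
    (* The left-hand side is the limit of the q-derivative of the integrated flux. The flux itself
       converges because [hq] tends to 0, so that limit must be zero. *)
    assert (Z : RInt (fun y => sig' y * (K y - H y)) x 0
      + ((- / 2 * (/ k x * / k x) + / 2 * (/ H' x * / H' x))
         + - (- / 2 * (/ k 0 * / k 0) + / 2 * (/ H' 0 * / H' 0))) = 0).
    { apply (deriv_limit_zero Fl Fl_shift
        (fun q => RInt (fun p => hq q p * / hp q p) x 0)
        (fun q => RInt (fun p => sig' p * (h q p - H p)) x 0 + (A q x + - A q 0))
        (RInt (fun p => 0 * / k p) x 0)).
      - intros q. now apply horizontal_flux_derive.
      - apply (bconv_RInt Fl).
        + intros q p. apply (continuity_2d_pt_section (fun u p => hq u p * / hp u p)).
          facts q p. cont2. lra.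
        + apply (bconv_mult Fl); assumption.
      - apply (conv_plus Fl); [|apply (conv_plus Fl); [|apply (conv_opp Fl)]].
        + apply (bconv_RInt Fl (fun q p => sig' p * (h q p - H p))).
          * intros q p.
            apply (continuity_2d_pt_section (fun q p => sig' p * (h q p - H p))), cont2_forcing.
          * apply (bconv_mult Fl); [|apply (bconv_minus Fl)]; assumption.
        + apply (bconv_conv Fl A _ x BA).
        + apply (bconv_conv Fl A _ 0 BA). }
    lra.
  - intros q.
    apply (conv_unique Fl (fun u => RInt (s u) (-1) 0)).
    + intros eps He. apply filter_forall. intros u.
      rewrite (flow_force_constant u q), Rminus_diag, Rabs_R0. assumption.
    + apply (bconv_RInt Fl); [|assumption]. intros; apply continuity_2d_pt_section, cont2_s.
Qed.

End Limit.

Context (sig_top : 0 <= sig 0) (sig'_neg : forall x, Ip x -> sig' x <= 0).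

(** [F1] is the end where the limit is known to be [H], [F2] the other end. The flow force is one
    number read off at both ends: its value 0 at the first supplies the hypothesis [flow] for the
    profile at the second. *)
Lemma ordered_limits_equal (F1 F2 : (R -> Prop) -> Prop)
  (PF1 : ProperFilter F1) (PF2 : ProperFilter F2)
  (F1_shift : forall P, F1 P -> F1 (fun q => forall t, 0 <= t <= 1 -> P (q + t)))
  (F2_shift : forall P, F2 P -> F2 (fun q => forall t, 0 <= t <= 1 -> P (q + t)))
  (K1 K2 : R -> R) (e : R)
  (KK1 : forall p, K1 (clamp p) = K1 p) (KK2 : forall p, K2 (clamp p) = K2 p)
  (limit1 : forall p, Ip p -> conv F1 (fun q => h q p) (K1 p))
  (limit2 : forall p, Ip p -> conv F2 (fun q => h q p) (K2 p))
  (K1_eq : forall p, Ip p -> K1 p = H p)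
  (e_sign : e = 1 \/ e = -1) (ordered : forall p, Ip p -> 0 <= e * (K2 p - H p)) :
  forall p, Ip p -> K2 p = H p.
Proof using All.
  destruct (limit_profile F1 F1_shift K1 KK1 limit1)
    as (k1 & _ & _ & _ & DK1 & _ & _ & _ & flow1).
  destruct (limit_profile F2 F2_shift K2 KK2 limit2)
    as (k2 & CK2 & Ck2 & k2_ge & DK2 & K2_bottom & K2_top & weak2 & flow2).
  assert (Ek : forall x, -1 < x < 0 -> k1 x = H' x).
  { intros x Hx. rewrite <- (is_derive_unique _ _ _ (DH x Hx)). symmetry.
    apply is_derive_unique. apply (is_derive_ext_loc (V := R_NormedModule) K1); [|now apply DK1].
    apply (locally_interval _ x (-1) 0); simpl; try lra.
    intros y Hy1 Hy2. apply K1_eq. unfold Ip; lra. }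
  apply (conjugate_flow_unique sig sig' H H' K2 k2 c e); auto.
  - now rewrite bottom_H.
  - rewrite <- (flow2 0), (flow1 0).
    rewrite (RInt_ext _ (fun _ => 0)).
    + rewrite RInt_const. unfold scal; simpl; unfold mult; simpl. apply Rmult_0_r.
    + rewrite Rmin_left, Rmax_right by lra. intros x Hx.
      rewrite Ek, K1_eq by (unfold Ip; lra). pose proof (Hpos x).
      match goal with |- ?a = ?b => change (@eq R a b) end. field. lra.
Qed.

End Strip.

(** * From the closed strip to the plane *)

(** Clearing the denominator gives a first-order expansion that also holds at [y = x]. *)
Lemma has_deriv_on_eps (D : R -> Prop) (f f' : R -> R) :
  has_deriv_on D f f' -> forall x, D x -> forall eps, 0 < eps ->
  exists d, 0 < d /\ forall y, D y -> Rabs (y - x) < d ->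
    Rabs (f y - f x - f' x * (y - x)) <= eps * Rabs (y - x).
Proof.
  intros Hf x Hx eps He. specialize (Hf x Hx).
  apply (filterlim_locally (U := R_UniformSpace)) with (eps := mkposreal eps He) in Hf.
  destruct Hf as [[d Hd] Hf]. exists d. split; [assumption|]. intros y Hy Hyx.
  destruct (Req_dec y x) as [->|Hn].
  - rewrite !Rminus_diag, Rmult_0_r, Rminus_0_r, Rabs_R0. lra.
  - specialize (Hf y Hyx (conj Hy Hn)).
    change (Rabs ((f y - f x) / (y - x) - f' x) < eps) in Hf.
    replace (f y - f x - f' x * (y - x)) with (((f y - f x) / (y - x) - f' x) * (y - x))
      by (field; lra).
    rewrite Rabs_mult. apply Rmult_le_compat_r; [apply Rabs_pos | lra].
Qed.

Lemma locally_clamp_id (x : R) : -1 < x < 0 -> locally x (fun y => clamp y = y).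
Proof.
  intros Hx. apply (locally_interval _ x (-1) 0); simpl; try lra.
  intros y Hy1 Hy2. apply clamp_id. unfold Ip; lra.
Qed.

Lemma has_deriv_on_is_derive (f f' : R -> R) (x : R) :
  has_deriv_on Ip f f' -> -1 < x < 0 -> is_derive f x (f' x).
Proof.
  intros Hf Hx. apply is_derive_Reals. intros eps He.
  destruct (has_deriv_on_eps Ip f f' Hf x ltac:(unfold Ip; lra) (eps / 2) ltac:(lra))
    as [d [Hd Hd']].
  assert (Hm : 0 < Rmin d (Rmin (x + 1) (- x))) by (repeat apply Rmin_pos; lra).
  exists (mkposreal _ Hm). intros t Ht Htd. cbn [pos] in Htd.
  assert (T1 := Rmin_l d (Rmin (x + 1) (- x))). assert (T2 := Rmin_r d (Rmin (x + 1) (- x))).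
  assert (T3 := Rmin_l (x + 1) (- x)). assert (T4 := Rmin_r (x + 1) (- x)).
  specialize (Hd' (x + t)). replace (x + t - x) with t in Hd' by ring.
  assert (Rabs (f (x + t) - f x - f' x * t) <= eps / 2 * Rabs t).
  { apply Hd'; [|lra]. assert (Rabs t < x + 1 /\ Rabs t < - x) as [U V] by lra.
    apply Rabs_def2 in U, V. unfold Ip; lra. }
  replace ((f (x + t) - f x) / t - f' x) with ((f (x + t) - f x - f' x * t) * / t) by (field; lra).
  rewrite Rabs_mult, Rabs_inv. assert (Pt := Rabs_pos_lt t Ht).
  apply Rmult_lt_reg_r with (Rabs t); [assumption|].
  rewrite Rmult_assoc, Rinv_l, Rmult_1_r by lra. nra.
Qed.

Lemma is_derive_clamp (f f' : R -> R) (x : R) :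
  has_deriv_on Ip f f' -> -1 < x < 0 ->
  is_derive (fun y => f (clamp y)) x (f' (clamp x)).
Proof.
  intros Hf Hx. rewrite clamp_id by (unfold Ip; lra).
  apply (is_derive_ext_loc (V := R_NormedModule) f).
  - generalize (locally_clamp_id x Hx). apply filter_imp. now intros y ->.
  - now apply has_deriv_on_is_derive.
Qed.

Lemma continuous_clamp (f f' : R -> R) (x : R) :
  has_deriv_on Ip f f' -> continuous (fun y => f (clamp y)) x.
Proof.
  intros Hf. apply (filterlim_locally (U := R_UniformSpace)). intros [eps He].
  destruct (has_deriv_on_eps Ip f f' Hf (clamp x) (clamp_Ip x) 1 ltac:(lra)) as [d [Hd Hd']].
  set (C := Rabs (f' (clamp x)) + 1).
  assert (HC : 0 < C) by (pose proof (Rabs_pos (f' (clamp x))); unfold C; lra).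
  assert (Hm : 0 < Rmin d (eps / C)) by (apply Rmin_pos; [|apply Rdiv_lt_0_compat]; lra).
  exists (mkposreal _ Hm). intros y Hy. change (Rabs (y - x) < Rmin d (eps / C)) in Hy.
  change (Rabs (f (clamp y) - f (clamp x)) < eps).
  assert (T1 := Rmin_l d (eps / C)). assert (T2 := Rmin_r d (eps / C)).
  assert (L := clamp_lipschitz y x).
  specialize (Hd' (clamp y) (clamp_Ip y) ltac:(lra)).
  replace (f (clamp y) - f (clamp x))
    with ((f (clamp y) - f (clamp x) - f' (clamp x) * (clamp y - clamp x))
          + f' (clamp x) * (clamp y - clamp x)) by ring.
  eapply Rle_lt_trans; [apply Rabs_triang|]. rewrite (Rabs_mult (f' (clamp x))).
  apply Rle_lt_trans with (C * Rabs (clamp y - clamp x)); [unfold C; lra|].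
  assert (U : Rabs (clamp y - clamp x) < eps / C) by lra.
  apply (Rmult_lt_compat_l C) in U; [|assumption].
  replace (C * (eps / C)) with eps in U by (field; lra). assumption.
Qed.

(** The regularity hypotheses only assert that some derivatives exist, while [rho_p] and [H_p] are
    given separately. Uniqueness on [-1, 0], ends included, transfers the regularity to them. *)
Lemma has_deriv_on_unique (f f1 f2 : R -> R) (x : R) :
  has_deriv_on Ip f f1 -> has_deriv_on Ip f f2 -> Ip x -> f1 x = f2 x.
Proof.
  intros H1 H2 Hx. destruct (Req_dec (f1 x) (f2 x)) as [|Hn]; [assumption|exfalso].
  assert (He : 0 < Rabs (f1 x - f2 x) / 4)
    by (apply Rdiv_lt_0_compat; [apply Rabs_pos_lt|]; lra).
  destruct (has_deriv_on_eps Ip f f1 H1 x Hx _ He) as [d1 [P1 Q1]].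
  destruct (has_deriv_on_eps Ip f f2 H2 x Hx _ He) as [d2 [P2 Q2]].
  (* The final halving makes the step strictly smaller than [d1] and [d2]. With errors of a quarter
     of the gap each, the gap would be at most half of itself. *)
  set (d := Rmin (1 / 2) (Rmin d1 d2) / 2).
  assert (Pm : 0 < Rmin (1 / 2) (Rmin d1 d2)) by (repeat apply Rmin_pos; lra).
  assert (T1 := Rmin_l (1 / 2) (Rmin d1 d2)). assert (T2 := Rmin_r (1 / 2) (Rmin d1 d2)).
  assert (T3 := Rmin_l d1 d2). assert (T4 := Rmin_r d1 d2).
  assert (Hs : exists t, Rabs t = d /\ Ip (x + t)).
  { destruct (Rle_dec x (- (1 / 2))); [exists d | exists (- d)];
      rewrite ?Rabs_Ropp, Rabs_pos_eq by (unfold d; lra);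
      (split; [reflexivity | unfold Ip, d in *; lra]). }
  destruct Hs as [t [Ht1 Ht2]].
  specialize (Q1 (x + t) Ht2). specialize (Q2 (x + t) Ht2).
  replace (x + t - x) with t in Q1, Q2 by ring. rewrite Ht1 in Q1, Q2.
  specialize (Q1 ltac:(unfold d; lra)). specialize (Q2 ltac:(unfold d; lra)).
  assert (U : Rabs ((f1 x - f2 x) * t) <= Rabs (f1 x - f2 x) / 4 * d + Rabs (f1 x - f2 x) / 4 * d).
  { replace ((f1 x - f2 x) * t)
      with ((f (x + t) - f x - f2 x * t) + - (f (x + t) - f x - f1 x * t)) by ring.
    eapply Rle_trans; [apply Rabs_triang|]. rewrite Rabs_Ropp. lra. }
  rewrite Rabs_mult, Ht1 in U.
  assert (0 < d) by (unfold d; lra). nra.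
Qed.

Lemma has_deriv_on_ext (D : R -> Prop) (f g f' : R -> R) :
  (forall x, D x -> f x = g x) -> has_deriv_on D f f' -> has_deriv_on D g f'.
Proof.
  intros E Hf x Hx. eapply filterlim_within_ext; [|exact (Hf x Hx)].
  intros y [Hy _]. now rewrite !E.
Qed.

Lemma has_deriv_on_lipschitz (f f' : R -> R) (M : R) :
  has_deriv_on Ip f f' -> (forall x, Ip x -> Rabs (f' x) <= M) ->
  forall x y, Rabs (f (clamp x) - f (clamp y)) <= M * Rabs (x - y).
Proof.
  intros Hf HM x y.
  assert (HM0 : 0 <= M) by (eapply Rle_trans; [apply Rabs_pos | apply (HM 0); unfold Ip; lra]).
  pose proof (clamp_Ip x) as Ix. pose proof (clamp_Ip y) as Iy.
  destruct (MVT_gen (fun z => f (clamp z)) (clamp y) (clamp x) (fun z => f' (clamp z)))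
    as [z [_ E]].
  - intros z Hz. apply is_derive_clamp; [assumption|].
    unfold Ip, Rmin, Rmax in *. destruct Rle_dec; lra.
  - intros z _. apply continuity_pt_filterlim. now apply (continuous_clamp f f').
  - rewrite !(clamp_id (clamp _)) in E by apply clamp_Ip. rewrite E, Rabs_mult.
    apply Rmult_le_compat; auto using Rabs_pos, clamp_Ip, clamp_lipschitz.
Qed.

Lemma bounded_clamp (f : R -> R) :
  (forall x, continuous (fun y => f (clamp y)) x) -> exists B, forall x, Rabs (f (clamp x)) <= B.
Proof.
  intros Hf.
  destruct (continuity_ab_maj (fun y => Rabs (f (clamp y))) (-1) 0) as [m [Hm _]].
  - lra.
  - intros z _. apply continuity_pt_filterlim.
    apply (continuous_comp (fun y => f (clamp y)) Rabs); [apply Hf | apply continuous_Rabs].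
  - exists (Rabs (f (clamp m))). intros x. pose proof (clamp_Ip x) as Hx.
    specialize (Hm (clamp x) Hx). now rewrite (clamp_id (clamp x)) in Hm.
Qed.

Lemma positive_clamp (f : R -> R) :
  (forall x, continuous (fun y => f (clamp y)) x) -> (forall x, Ip x -> 0 < f x) ->
  exists B, 0 < B /\ forall x, B <= f (clamp x).
Proof.
  intros Hf Hp.
  destruct (continuity_ab_min (fun y => f (clamp y)) (-1) 0) as [m [Hm Im]].
  - lra.
  - intros z _. apply continuity_pt_filterlim, Hf.
  - exists (f (clamp m)). split; [apply Hp, clamp_Ip|]. intros x. pose proof (clamp_Ip x) as Hx.
    specialize (Hm (clamp x) Hx). now rewrite (clamp_id (clamp x)) in Hm.
Qed.

(** The lower bound on [hp] is assumed in the open strip; continuity carries it to the walls, where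
    the surface condition divides by [hp]. *)
Lemma ge_closure (f : R -> R) (c : R) :
  (forall x, continuous (fun y => f (clamp y)) x) -> (forall x, -1 < x < 0 -> c <= f x) ->
  forall x, c <= f (clamp x).
Proof.
  intros Hf Hc x. apply Rnot_lt_le. intros Hl. set (y := clamp x) in *.
  assert (Hy : Ip y) by apply clamp_Ip.
  specialize (Hf y). apply (filterlim_locally (U := R_UniformSpace)) with
    (eps := mkposreal (c - f y) ltac:(lra)) in Hf.
  destruct Hf as [[d Hd] Hf]. cbn [pos] in Hf.
  assert (Hm : 0 < Rmin d (1 / 2)) by (apply Rmin_pos; lra).
  assert (T1 := Rmin_l d (1 / 2)). assert (T2 := Rmin_r d (1 / 2)).
  assert (Hz : exists z, Rabs (z - y) < d /\ -1 < z < 0).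
  { destruct (Rle_dec y (- (1 / 2)));
      [exists (y + Rmin d (1 / 2) / 2) | exists (y - Rmin d (1 / 2) / 2)];
      (split; [apply Rabs_def1; lra | unfold Ip in Hy; lra]). }
  destruct Hz as [z [Hz1 Hz2]]. specialize (Hf z Hz1).
  change (Rabs (f (clamp z) - f (clamp y)) < c - f y) in Hf.
  rewrite !clamp_id in Hf by (unfold Ip in *; lra). apply Rabs_def2 in Hf.
  specialize (Hc z Hz2). lra.
Qed.

Lemma cont_strip_clamp (g : R -> R -> R) (q p : R) :
  cont_strip g -> continuity_2d_pt (fun q p => g q (clamp p)) q p.
Proof.
  intros Hg [eps He]. destruct (Hg q (clamp p) (clamp_Ip p) eps He) as [d [Hd Hd']].
  exists (mkposreal d Hd). intros u v Hu Hv. apply Hd'; [apply clamp_Ip | exact Hu |].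
  eapply Rle_lt_trans; [apply clamp_lipschitz | exact Hv].
Qed.

Lemma is_lim_conv (f : R -> R) (x : Rbar) (l : R) :
  is_lim f x l -> conv (Rbar_locally' x) f l.
Proof.
  intros Hf eps He.
  apply (filterlim_locally (U := R_UniformSpace)) with (eps := mkposreal eps He) in Hf.
  exact Hf.
Qed.

Lemma p_infty_shift (P : R -> Prop) :
  Rbar_locally' p_infty P ->
  Rbar_locally' p_infty (fun q => forall t, 0 <= t <= 1 -> P (q + t)).
Proof. intros [m Hm]. exists m. intros q Hq t Ht. apply Hm. lra. Qed.

Lemma m_infty_shift (P : R -> Prop) :
  Rbar_locally' m_infty P ->
  Rbar_locally' m_infty (fun q => forall t, 0 <= t <= 1 -> P (q + t)).
(* The shift moves back towards the threshold, which is therefore lowered by 1. *)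
Proof. intros [m Hm]. exists (m - 1). intros q Hq t Ht. apply Hm. lra. Qed.

(** * The height equation on the clamped strip *)

Section HeightEquation.

Context (alpha F : R) (rho rho_p H H_p : R -> R).
Context (Hrho_reg : C2a alpha rho) (Hrho_d : has_deriv_on Ip rho rho_p)
  (Hrho_pos : forall p, Ip p -> 0 < rho p) (Hrho_p : forall p, Ip p -> rho_p p <= 0)
  (HH_reg : C3a alpha H) (HH_d : has_deriv_on Ip H H_p)
  (HHm1 : H (-1) = 0) (HH0 : H 0 = 1) (HH_p : forall p, Ip p -> 0 < H_p p) (HF : 0 < F).
Context (h hq hp : R -> R -> R) (Hh_reg : C2_bounded_strip h hq hp)
  (Hh_eq : height_eq F rho rho_p H H_p h hq hp)
  (Hh_inf : exists c, 0 < c /\ forall q p, -1 < p < 0 -> c <= hp q p).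

Lemma ordered_far_fields_equal (F1 F2 : (R -> Prop) -> Prop)
  (PF1 : ProperFilter F1) (PF2 : ProperFilter F2)
  (F1_shift : forall P, F1 P -> F1 (fun q => forall t, 0 <= t <= 1 -> P (q + t)))
  (F2_shift : forall P, F2 P -> F2 (fun q => forall t, 0 <= t <= 1 -> P (q + t)))
  (K1 K2 : R -> R) (e : R)
  (limit1 : forall p, Ip p -> conv F1 (fun q => h q p) (K1 p))
  (limit2 : forall p, Ip p -> conv F2 (fun q => h q p) (K2 p))
  (K1_eq : forall p, Ip p -> K1 p = H p)
  (e_sign : e = 1 \/ e = -1) (ordered : forall p, Ip p -> 0 <= e * (K2 p - H p)) :
  forall p, Ip p -> K2 p = H p.
Proof using All.
  destruct Hrho_reg as (r1 & r2 & Dr & Dr1 & _).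
  destruct HH_reg as (H1 & H2 & H3 & DH1 & DH2 & _).
  (* [rho_p] agrees on [-1, 0] with the derivative provided by [C2a], so it is differentiable and in
     particular continuous; likewise for [H_p] below. *)
  assert (Drp : has_deriv_on Ip rho_p r2).
  { refine (has_deriv_on_ext _ r1 _ _ _ Dr1). intros x Hx.
    now apply (has_deriv_on_unique rho). }
  assert (DHp : has_deriv_on Ip H_p H2).
  { refine (has_deriv_on_ext _ H1 _ _ _ DH2). intros x Hx.
    now apply (has_deriv_on_unique H). }
  clear r1 Dr Dr1 H1 H3 DH1 DH2.
  destruct Hh_reg as (Dhq & Dhp & hqq & hqp & hpq & hpp & Dhqq & Dhqp & Dhpq & Dhpp &
    Ch & Chq & Chp & Chqq & _ & Chpq & _ & Mh & HMh).
  destruct Hh_inf as (c1 & c1_pos & Hc1).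
  destruct Hh_eq as (Eint & Etop & Ebot).
  assert (CH : forall x, continuous (fun y => H (clamp y)) x)
    by (intros; now apply continuous_clamp with H_p).
  assert (CHp : forall x, continuous (fun y => H_p (clamp y)) x)
    by (intros; now apply continuous_clamp with H2).
  assert (Cr : forall x, continuous (fun y => rho (clamp y)) x)
    by (intros; now apply continuous_clamp with rho_p).
  assert (Crp : forall x, continuous (fun y => rho_p (clamp y)) x)
    by (intros; now apply continuous_clamp with r2).
  assert (HF2 : 0 < / F ^ 2) by (apply Rinv_0_lt_compat; nra).
  assert (Cs : forall x, continuous (fun y => / F ^ 2 * rho (clamp y)) x)
    by (intros; apply continuous_mult_R; [apply continuous_const | apply Cr]).
  assert (Csp : forall x, continuous (fun y => / F ^ 2 * rho_p (clamp y)) x)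
    by (intros; apply continuous_mult_R; [apply continuous_const | apply Crp]).
  destruct (positive_clamp H_p CHp HH_p) as (c2 & c2_pos & Hc2).
  destruct (bounded_clamp H CH) as [M1 B1].
  destruct (bounded_clamp H_p CHp) as [M2 B2].
  destruct (bounded_clamp (fun x => / F ^ 2 * rho x) Cs) as [M3 B3].
  destruct (bounded_clamp (fun x => / F ^ 2 * rho_p x) Csp) as [M4 B4].
  assert (P0 : 0 <= Mh).
  { eapply Rle_trans; [apply Rabs_pos|]. apply (HMh 0 0). unfold Ip; lra. }
  assert (P1 : 0 <= M1) by (eapply Rle_trans; [apply Rabs_pos | apply (B1 0)]).
  assert (P2 : 0 <= M2) by (eapply Rle_trans; [apply Rabs_pos | apply (B2 0)]).
  assert (P3 : 0 <= M3) by (eapply Rle_trans; [apply Rabs_pos | apply (B3 0)]).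
  assert (P4 : 0 <= M4) by (eapply Rle_trans; [apply Rabs_pos | apply (B4 0)]).
  set (M := Mh + M1 + M2 + M3 + M4). set (c := Rmin c1 c2).
  assert (c_pos : 0 < c) by (now apply Rmin_pos).
  assert (hp_ge : forall q p, c1 <= hp q (clamp p)).
  { intros q. apply (ge_closure (hp q)); [|apply Hc1].
    intros x. apply (continuous_clamp _ (hpp q)), Dhpp. }
  assert (HMh' : forall q p, Ip p -> Rabs (h q p) <= M /\ Rabs (hq q p) <= M /\
    Rabs (hp q p) <= M /\ Rabs (hqq q p) <= M /\ Rabs (hqp q p) <= M /\
    Rabs (hpp q p) <= M).
  { intros q p Hp. specialize (HMh q p Hp). unfold M. repeat split; lra. }
  assert (Emid : forall p, Ip p -> K2 (clamp p) = H (clamp p)).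
  { apply (ordered_limits_equal
      (fun x => / F ^ 2 * rho (clamp x)) (fun x => / F ^ 2 * rho_p (clamp x))
      (fun x => H (clamp x)) (fun x => H_p (clamp x))
      (fun q p => h q (clamp p)) (fun q p => hq q (clamp p)) (fun q p => hp q (clamp p))
      (fun q p => hqq q (clamp p)) (fun q p => hqp q (clamp p)) (fun q p => hpq q (clamp p))
      c M) with (F1 := F1) (F2 := F2) (e := e)
      (K1 := fun p => K1 (clamp p)) (K2 := fun p => K2 (clamp p));
      try assumption;
      try lazymatch goal with
      | |- forall _ _, continuity_2d_pt _ _ _ => intros; now apply cont_strip_clamp
      | |- forall _, _ = _ => intros; now rewrite (clamp_id (clamp _)) by apply clamp_Ip
      | |- forall _ _, _ = _ => intros; now rewrite (clamp_id (clamp _)) by apply clamp_Ip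
      | |- forall _ _, Rabs _ <= M => intros; apply HMh', clamp_Ip
      end.
    - intros x. apply Rle_trans with c2; [apply Rmin_r | apply Hc2].
    - intros q p. apply Rle_trans with c1; [apply Rmin_l | apply hp_ge].
    - intros x Hx. eapply is_derive_eq.
      + apply is_derive_mult_R; [apply is_derive_const_R | now apply (is_derive_clamp rho rho_p)].
      + cbv beta. ring.
    - intros x. now apply is_derive_clamp.
    - intros q p. apply Dhq, clamp_Ip.
    - intros q p. apply Dhqq, clamp_Ip.
    - intros q p. apply Dhpq, clamp_Ip.
    - intros q p. apply (is_derive_clamp (h q) (hp q)), Dhp.
    - intros q p. apply (is_derive_clamp (hq q) (hqp q)), Dhqp.
    - intros x. specialize (B3 x). unfold M. cbv beta in B3. lra.
    - intros x. specialize (B4 x). unfold M. cbv beta in B4. lra.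
    - intros x. specialize (B1 x). unfold M. lra.
    - intros x. specialize (B2 x). unfold M. lra.
    - intros q. apply (has_deriv_on_lipschitz (h q) (hp q)); [apply Dhp|]. intros; now apply HMh'.
    - intros q. apply (has_deriv_on_lipschitz (hq q) (hqp q)); [apply Dhqp|]. intros; now apply HMh'.
    - intros q. apply (has_deriv_on_lipschitz (hp q) (hpp q)); [apply Dhpp|]. intros; now apply HMh'.
    - intros q p Hp. assert (Ipp : Ip p) by (unfold Ip; lra).
      pose proof (hp_ge q p) as G1. pose proof (Hc2 p) as G2. rewrite !clamp_id in * by assumption.
      pose proof (has_deriv_on_is_derive _ _ p (Dhqp q) Hp) as D1.
      pose proof (has_deriv_on_is_derive _ _ p (Dhpp q) Hp) as D2.
      pose proof (has_deriv_on_is_derive _ _ p DHp Hp) as D3.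
      pose proof (Dhqq q p Ipp) as D4. pose proof (Dhpq q p Ipp) as D5.
      (* [Derive] is total, so the equation in [Eint] says something about a derivative only once
         that derivative is known to exist. *)
      assert (DA : exists L, is_derive (fun x => - / 2 * ((1 + hq q x * hq q x) * (/ hp q x * / hp q x))
                             + / 2 * (/ H_p x * / H_p x)) p L).
      { eexists. der; lra. }
      destruct DA as [L DA].
      assert (DJ : Derive (fun q' => hq q' p / hp q' p) q
        = hqq q p * / hp q p - hq q p * hpq q p * (/ hp q p * / hp q p)).
      { apply is_derive_unique. unfold Rdiv. eapply is_derive_eq; [der; lra|]. cbv beta.
        field. lra. }
      specialize (Eint q p Hp). rewrite DJ in Eint.
      apply (is_derive_ext_loc (V := R_NormedModule)
        (fun x => - / 2 * ((1 + hq q x * hq q x) * (/ hp q x * / hp q x))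
                             + / 2 * (/ H_p x * / H_p x))).
      { generalize (locally_clamp_id p Hp). apply filter_imp. now intros y ->. }
      apply (is_derive_eq _ _ L); [assumption|].
      rewrite <- (is_derive_unique _ _ _ DA).
      (* The two forms of the flux are compared only near [p] inside the strip, where [hp] and [H_p]
         are positive. *)
      rewrite <- (Derive_ext_loc (fun p' : R => - (1 + hq q p' ^ 2) / (2 * hp q p' ^ 2)
         + 1 / (2 * H_p p' ^ 2))); [lra|].
      apply (locally_interval _ p (-1) 0); simpl; try lra.
      intros y Hy1 Hy2. specialize (Hc1 q y ltac:(split; assumption)).
      specialize (HH_p y ltac:(unfold Ip; split; lra)). field. lra.
    - intros q. rewrite !(clamp_id 0) by (unfold Ip; lra). specialize (Etop q).
      pose proof (hp_ge q 0) as G1. pose proof (Hc2 0) as G2.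
      (* [H 0 = 1] turns [h - 1] in the surface condition into [h - H]. *)
      rewrite !(clamp_id 0) in * by (unfold Ip; lra). rewrite HH0.
      replace (/ F ^ 2 * rho 0 * (h q 0 - 1)) with
        (- ((1 + hq q 0 ^ 2) / (2 * hp q 0 ^ 2) - 1 / (2 * H_p 0 ^ 2))) by lra.
      field. lra.
    - intros q. rewrite clamp_id by (unfold Ip; lra). apply Ebot.
    - rewrite clamp_id by (unfold Ip; lra). assumption.
    - apply Rmult_le_pos; [lra|]. left. apply Hrho_pos, clamp_Ip.
    - intros x Hx. specialize (Hrho_p (clamp x) (clamp_Ip x)). nra.
    - intros p Hp. rewrite clamp_id by assumption. now apply limit1.
    - intros p Hp. rewrite clamp_id by assumption. now apply limit2.
    - intros p Hp. apply K1_eq, clamp_Ip.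
    - intros p Hp. apply ordered, clamp_Ip. }
  intros p Hp. specialize (Emid p Hp). now rewrite !clamp_id in Emid.
Qed.

End HeightEquation.

Theorem theorem4p8
  (alpha F : R) (rho rho_p H H_p : R -> R)
  (Halpha : 0 < alpha < 1)
  (Hrho_reg : C2a alpha rho) (Hrho_d : has_deriv_on Ip rho rho_p)
  (Hrho_pos : forall p, Ip p -> 0 < rho p)
  (Hrho_p : forall p, Ip p -> rho_p p <= 0)
  (HH_reg : C3a alpha H) (HH_d : has_deriv_on Ip H H_p)
  (HHm1 : H (-1) = 0) (HH0 : H 0 = 1)
  (HH_p : forall p, Ip p -> 0 < H_p p)
  (HF : 0 < F)
  (h hq hp : R -> R -> R) (Hplus Hminus : R -> R)
  (Hh_reg : C2_bounded_strip h hq hp)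
  (Hh_eq : height_eq F rho rho_p H H_p h hq hp)
  (Hh_inf : exists c, 0 < c /\ forall q p, -1 < p < 0 -> c <= hp q p)
  (Hlim_plus : forall p, Ip p -> is_lim (fun q => h q p) p_infty (Hplus p))
  (Hlim_minus : forall p, Ip p -> is_lim (fun q => h q p) m_infty (Hminus p)) :
  (((forall p, Ip p -> Hplus p >= Hminus p /\ Hminus p = H p) \/
    (forall p, Ip p -> Hplus p <= Hminus p /\ Hminus p = H p)) ->
   forall p, Ip p -> Hplus p = H p /\ Hminus p = H p) /\
  (((forall p, Ip p -> Hminus p >= Hplus p /\ Hplus p = H p) \/
    (forall p, Ip p -> Hminus p <= Hplus p /\ Hplus p = H p)) ->
   forall p, Ip p -> Hplus p = H p /\ Hminus p = H p).
Proof.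
  assert (Lp : forall p, Ip p -> conv (Rbar_locally' p_infty) (fun q => h q p) (Hplus p))
    by (intros; now apply is_lim_conv, Hlim_plus).
  assert (Lm : forall p, Ip p -> conv (Rbar_locally' m_infty) (fun q => h q p) (Hminus p))
    by (intros; now apply is_lim_conv, Hlim_minus).
  pose proof (ordered_far_fields_equal alpha F rho rho_p H H_p Hrho_reg Hrho_d Hrho_pos Hrho_p
    HH_reg HH_d HHm1 HH0 HH_p HF h hq hp Hh_reg Hh_eq Hh_inf) as Key.
  (* [Kp] takes the limit at minus infinity as the known one and concludes at plus infinity; [Km]
     does the reverse. The sign is 1 when the unknown limit lies above [H] and -1 when it lies
     below. *)
  pose proof (fun K1 K2 e => Key _ _ _ _ m_infty_shift p_infty_shift K1 K2 e) as Kp.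
  pose proof (fun K1 K2 e => Key _ _ _ _ p_infty_shift m_infty_shift K1 K2 e) as Km.
  clear Key.
  split; intros [A|A] p Hp; split; try (now apply A).
  - apply (Kp Hminus Hplus 1); auto; intros r Hr; destruct (A r Hr); lra.
  - apply (Kp Hminus Hplus (-1)); auto; intros r Hr; destruct (A r Hr); lra.
  - apply (Km Hplus Hminus 1); auto; intros r Hr; destruct (A r Hr); lra.
  - apply (Km Hplus Hminus (-1)); auto; intros r Hr; destruct (A r Hr); lra.
Qed.
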